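(* For integers $n\ge 1$ and $d\ge 2$ put $\alpha_{[n,d]}:=\frac{1}{d-2}\left((d-1)^{n-1}-(d-1)\right)$. For a homogeneous Hessian nilpotent polynomial $P(z)\in\mathbb{C}[z_1,\dots,z_n]$ of degree $d\ge 2$ consider the statements (1) $\Delta^m P^{m+1}=0$ for any integer $m\ge 0$ with $m>\alpha_{[n,d]}$; (2) for any $k\ge 1$, $\Delta^m P^{m+k}=0$ for any integer $m\ge 0$ with $m>k\,\alpha_{[n,d]}$. Then: (a) For any homogeneous Hessian nilpotent polynomial $P(z)$ of degree $d\ge 2$, statements (1) and (2) are equivalent. (b) Each of the following two assertions is equivalent to the Jacobian conjecture: (i) for all $n\ge 1$ and all $d\ge 2$, (1) and (2) hold for every homogeneous Hessian nilpotent polynomial of degree $d$ in $n$ variables; (ii) for all $n\ge 1$, (1) and (2) hold for every homogeneous Hessian nilpotent polynomial of degree $d=4$ in $n$ variables.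
   Context: Here $z=(z_1,\dots,z_n)$ and $\Delta=\sum_{i=1}^n \partial^2/\partial z_i^2$. A polynomial $P$ is Hessian nilpotent if its Hessian matrix $\left(\frac{\partial^2 P}{\partial z_i\partial z_j}\right)$ is nilpotent. The Jacobian conjecture is the assertion: for every $n\ge 1$ and every polynomial map $F(z)=z-H(z)$ from $\mathbb{C}^n$ to $\mathbb{C}^n$, where all components of $H$ have only monomials of degree $\ge 2$, with Jacobian determinant $j(F)(z)=1$ identically, the formal inverse map of $F$ is a polynomial map.
   Formalization: For d = 2 the formula for α_{[n,d]} is 0/0 and hence undefined; there it is read as its continuous extension in d, α_{[n,2]} = n − 2. *)

(* Defs.v *)
From HB Require Import structures.
From mathcomp Require Import all_boot all_order all_algebra.
From mathcomp Require Import complex mpoly.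
From mathcomp Require Import reals.

Set Implicit Arguments.
Unset Strict Implicit.
Unset Printing Implicit Defensive.

Import Order.TTheory GRing.Theory Num.Theory.

Local Open Scope ring_scope.

Section Polynomials.
Variables (K : comNzRingType) (n : nat).
Implicit Types (P : {mpoly K[n]}) (F : 'I_n -> {mpoly K[n]}).

Definition laplacian P : {mpoly K[n]} := \sum_(i < n) P^`M(i)^`M(i).

Definition hessian P : 'M[{mpoly K[n]}]_n :=
  \matrix_(i < n, j < n) P^`M(i)^`M(j).

Definition hessian_nilpotent P : Prop := exists r : nat, hessian P ^+ r = 0.

Definition jacobian F : 'M[{mpoly K[n]}]_n :=
  \matrix_(i < n, j < n) (F i)^`M(j).

End Polynomials.

(* A formal power series in n variables is its family of coefficients. *)
Definition mseries (K : Type) (n : nat) : Type := 'X_{1..n} -> K.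

Section Series.
Variables (K : comNzRingType) (n : nat).
Implicit Types (f : mseries K n) (g F G : 'I_n -> mseries K n).

Definition mseries_of_mpoly (p : {mpoly K[n]}) : mseries K n :=
  fun m => p@_m.

Definition is_mpoly f : Prop :=
  exists p : {mpoly K[n]}, forall m, f m = mseries_of_mpoly p m.

(* The part of f of total degree at most N. *)
Definition truncate (N : nat) f : {mpoly K[n]} :=
  \sum_(m : 'X_{1..n < N.+1}) f m *: 'X_[m].

(* The substitution f(g_1, ..., g_n), for g with zero constant terms: terms of
   f or of g of degree larger than that of m do not contribute to the
   coefficient of m. *)
Definition mseries_comp f g : mseries K n :=
  fun m => (comp_mpoly [tuple truncate (mdeg m) (g i) | i < n]
              (truncate (mdeg m) f))@_m.

Definition is_formal_inverse F G : Prop :=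
  [/\ forall i, G i 0%MM = 0,
      forall i m, mseries_comp (F i) G m = mseries_of_mpoly 'X_i m
    & forall i m, mseries_comp (G i) F m = mseries_of_mpoly 'X_i m].

(* For F with F(0) = 0 a formal inverse is unique, so the existential
   describes "the" formal inverse of F. *)
Definition has_polynomial_formal_inverse (F : 'I_n -> {mpoly K[n]}) : Prop :=
  exists G : 'I_n -> mseries K n,
    is_formal_inverse (fun i => mseries_of_mpoly (F i)) G /\
    (forall i, is_mpoly (G i)).

End Series.

Definition jacobian_conjecture (K : comNzRingType) : Prop :=
  forall (n : nat) (H : 'I_n -> {mpoly K[n]}),
    (1 <= n)%N ->
    (forall i m, m \in msupp (H i) -> (2 <= mdeg m)%N) ->
    let F := fun i : 'I_n => 'X_i - H i in
    \det (jacobian F) = 1 ->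
    has_polynomial_formal_inverse F.

(* For d = 2 the quotient is 0/0; it is read as its limit when d tends to 2,
   i.e. as the value n - 2 of the polynomial in d that the quotient equals for
   n >= 2, (d-1) + (d-1)^2 + ... + (d-1)^(n-2); for n = 1 the quotient is the
   constant -1 = n - 2. *)
Definition alpha (n d : nat) : rat :=
  if d == 2%N then n%:R - 2
  else (d%:R - 2)^-1 * ((d%:R - 1) ^+ n.-1 - (d%:R - 1)).

Section Vanishing.
Variables (K : comNzRingType) (n d : nat) (P : {mpoly K[n]}).

Definition vanishing1 : Prop :=
  forall m : nat, alpha n d < m%:R ->
    iter m (@laplacian K n) (P ^+ (m + 1)) = 0.

Definition vanishing2 : Prop :=
  forall k : nat, (1 <= k)%N ->
  forall m : nat, k%:R * alpha n d < m%:R ->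
    iter m (@laplacian K n) (P ^+ (m + k)) = 0.

End Vanishing.

(* Main.v *)
(* Let Q be the solution of dQ/dt = |grad Q|^2 / 2 with Q = P at t = 0. Along
   the derivation D = d/dt - grad Q . grad, the Hessian M of Q satisfies
   D M = M^2, so the traces of its powers, which vanish at t = 0 because P is
   Hessian nilpotent, vanish identically. Hence Q is harmonic, which yields
   d(Q^k)/dt = Delta(Q^(k+1)) / (2 (k+1)), and the coefficient of t^m in Q^k is
   a nonzero multiple of Delta^m P^(m+k). So (1) bounds the degree of Q in t by
   alpha, and (2) follows for its powers.

   Moreover D kills x + t grad Q, so that x + t grad Q is the inverse of
   x - t grad P. If (1) holds, this inverse is polynomial. Conversely, if
   x - grad P has a polynomial inverse, its degree is at most (d-1)^(n-1) (the
   bound of Gabber), and comparing degrees gives (1). The degree bound is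
   obtained by counting: with c the leading exponent of G_j, the polynomials
   F^a x_j^b where x^c does not divide x^a are linearly independent.

   That the quartic case implies the Jacobian conjecture follows by reducing the
   degree to 3 (Bass-Connell-Wright, Yagzhev), homogenizing, and passing to a
   gradient map in twice as many variables (de Bondt-van den Essen, Meng). *)

Require Import Defs.
From HB Require Import structures.
From mathcomp Require Import all_boot all_order all_algebra.
From mathcomp Require Import complex mpoly.
From mathcomp Require Import reals.
From mathcomp Require Import ring lra zify.

Set Implicit Arguments.
Unset Strict Implicit.
Unset Printing Implicit Defensive.

Import Order.TTheory GRing.Theory Num.Theory.

Local Open Scope ring_scope.

(** * Substitution of polynomials and the chain rule *)

Notation msub g := (mmap (@mpolyC _ _) g).

Section Substitution.
Variables (K : comNzRingType) (n : nat).
Implicit Types (p q : {mpoly K[n]}).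

Lemma mpoly_ind (Q : {mpoly K[n]} -> Prop) :
  (forall c, Q c%:MP) -> (forall i, Q 'X_i) ->
  (forall p q, Q p -> Q q -> Q (p + q)) ->
  (forall p q, Q p -> Q q -> Q (p * q)) -> forall p, Q p.
Proof.
move=> QC QX QD QM p; rewrite [p]mpolyE.
elim/big_ind: _ => [||m _] //; first by rewrite -[0]/(0%:MP).
rewrite -mul_mpolyC; apply: (QM) => //; rewrite mpolyXE_id.
elim/big_ind: _ => [||i _] //; first by rewrite -[1]/(1%:MP).
elim: (m i) => [|k IH]; first by rewrite expr0 -[1]/(1%:MP).
by rewrite exprS; apply: QM.
Qed.

Lemma mmapXU (S : comNzRingType) (f : {rmorphism K -> S}) (h : 'I_n -> S) i :
  mmap f h 'X_i = h i.
Proof. by rewrite mmapX mmap1U. Qed.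

Lemma rmorph_mmap (S : comNzRingType) (phi psi : {rmorphism {mpoly K[n]} ->
  S}) :
  (forall c, phi c%:MP = psi c%:MP) -> (forall i, phi 'X_i = psi 'X_i) ->
  phi =1 psi.
Proof.
move=> eC eX; elim/mpoly_ind => [//|//|p q IHp IHq|p q IHp IHq].
  by rewrite !rmorphD IHp IHq.
by rewrite !rmorphM IHp IHq.
Qed.

Lemma eq_mmap (S : comNzRingType) (f f' : {rmorphism K -> S}) (h h' : 'I_n ->
  S) :
  f =1 f' -> h =1 h' -> mmap f h =1 mmap f' h'.
Proof.
move=> ef eh; apply: (rmorph_mmap (phi := mmap f h) (psi := mmap f' h')).
  by move=> c; rewrite /= !mmapC /= ef.
by move=> i; rewrite /= !mmapXU eh.
Qed.

Lemma rmorph_comp_mmap (S T : comNzRingType) (f : {rmorphism K -> S})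
    (g : {rmorphism K -> T}) (h : 'I_n -> S) (phi : {rmorphism S -> T}) p :
  (forall c, phi (f c) = g c) ->
  phi (mmap f h p) = mmap g (fun i => phi (h i)) p.
Proof.
move=> e; apply: (rmorph_mmap (phi := phi \o mmap f h)
  (psi := mmap g (fun i => phi (h i)))) => [c|i] /=.
  by rewrite !mmapC /= e.
by rewrite !mmapXU.
Qed.

Lemma msub_id p : msub (fun i => 'X_i) p = p.
Proof.
apply: (rmorph_mmap (phi := msub (fun i => 'X_i)) (psi := idfun)) => [c|i].
  by rewrite /= mmapC.
by rewrite /= mmapXU.
Qed.

Lemma msub_comp k l (g : 'I_n -> {mpoly K[k]}) (h : 'I_k -> {mpoly K[l]}) p :
  msub h (msub g p) = msub (fun i => msub h (g i)) p.
Proof. by apply: rmorph_comp_mmap => c /=; rewrite mmapC. Qed.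

Lemma mmap_msub (S : comNzRingType) (f : {rmorphism K -> S}) k
    (g : 'I_n -> {mpoly K[k]}) (h : 'I_k -> S) p :
  mmap f h (msub g p) = mmap f (fun i => mmap f h (g i)) p.
Proof. by apply: rmorph_comp_mmap => c /=; rewrite mmapC. Qed.

Lemma comp_mpoly_msub k (g : 'I_n -> {mpoly K[k]}) p :
  p \mPo [tuple g i | i < n] = msub g p.
Proof. by apply: eq_mmap => // i; rewrite tnth_mktuple. Qed.

Lemma mderivXU (i j : 'I_n) : ('X_j : {mpoly K[n]})^`M(i) = (j == i)%:R.
Proof.
rewrite mderivX mnm1E; have [->|_] := eqVneq j i; last by rewrite scale0r.
have -> : (U_(i) - U_(i) = 0 :> 'X_{1..n})%MM.
  by apply/mnmP => k; rewrite mnmBE mnm0E subnn.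
by rewrite scale1r mpolyX0.
Qed.

(** By the Leibniz rule it suffices to check generators. [D] is arbitrary so as to cover both
    partial derivatives and the derivation along the flow. *)
Lemma derivation_mmap (S : comNzRingType) (f : {rmorphism K -> S})
    (h : 'I_n -> S) (D : {additive S -> S}) :
  (forall a b, D (a * b) = D a * b + a * D b) -> (forall c, D (f c) = 0) ->
  forall p, D (mmap f h p) = \sum_(i < n) mmap f h p^`M(i) * D (h i).
Proof.
move=> DM DC; elim/mpoly_ind => [c|j|p q IHp IHq|p q IHp IHq].
- rewrite mmapC DC big1 // => i _; by rewrite mderivC mmap0 mul0r.
- rewrite mmapXU (bigD1 j) //= mderivXU eqxx rmorph1 mul1r big1 ?addr0 // =>
  i ij.
  by rewrite mderivXU eq_sym (negbTE ij) rmorph0 mul0r.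
- rewrite !raddfD /= IHp IHq -big_split; apply: eq_bigr => i _.
  by rewrite mderivD rmorphD mulrDl.
rewrite rmorphM DM IHp IHq mulr_suml mulr_sumr -big_split.
apply: eq_bigr => i _; rewrite mderivM rmorphD !rmorphM /=; ring.
Qed.

Lemma mderiv_msub k (g : 'I_n -> {mpoly K[k]}) p j :
  (msub g p)^`M(j) = \sum_(i < n) msub g p^`M(i) * (g i)^`M(j).
Proof.
apply: (@derivation_mmap _ (@mpolyC k K) g (mderiv j)) => [a b|c] /=;
  first exact: mderivM.
exact: mderivC.
Qed.

End Substitution.

(** A set of allowed degrees expresses homogeneity ([pred1 d]), lower bounds on the order ([leq a])
    and upper bounds on the degree alike. *)
Definition degs (K : comNzRingType) n (S : pred nat) (p : {mpoly K[n]}) :=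
  forall m, m \in msupp p -> S (mdeg m).

(** * Calculus of degrees *)

Section Degrees.
Variables (K : comNzRingType) (n : nat).
Implicit Types (p q : {mpoly K[n]}) (S T : pred nat).

Lemma degsW S T p : (forall a, S a -> T a) -> degs S p -> degs T p.
Proof. by move=> ST Sp m /Sp /ST. Qed.

Lemma degsD S p q : degs S p -> degs S q -> degs S (p + q).
Proof. by move=> Sp Sq m /msuppD_le; rewrite mem_cat => /orP[/Sp|/Sq]. Qed.

Lemma degsN S p : degs S p -> degs S (- p).
Proof. by move=> Sp m; rewrite (perm_mem (msuppN p)) => /Sp. Qed.

Lemma degsB S p q : degs S p -> degs S q -> degs S (p - q).
Proof. by move=> Sp Sq; apply: degsD => //; apply: degsN. Qed.

Lemma degs0 S : degs S (0 : {mpoly K[n]}).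
Proof. by move=> m; rewrite msupp0. Qed.

Lemma degsZ S c p : degs S p -> degs S (c *: p).
Proof. by move=> Sp m /msuppZ_le /Sp. Qed.

Lemma degsX S m : S (mdeg m) -> degs S ('X_[m] : {mpoly K[n]}).
Proof. by move=> Sm m'; rewrite msuppX inE => /eqP->. Qed.

Lemma degsXU S i : S 1%N -> degs S ('X_i : {mpoly K[n]}).
Proof. by move=> S1; apply: degsX; rewrite mdeg1. Qed.

Lemma degs1 S : S 0%N -> degs S (1 : {mpoly K[n]}).
Proof. by move=> S0 m; rewrite msupp1 inE => /eqP->; rewrite mdeg0. Qed.

Lemma degs_sum S (I : Type) (r : seq I) (P : pred I) (F : I -> {mpoly K[n]}) :
  (forall i, P i -> degs S (F i)) -> degs S (\sum_(i <- r | P i) F i).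
Proof.
move=> SF; apply: (big_ind (degs S)) => //; first exact: degs0.
by move=> p q; apply: degsD.
Qed.

Lemma degsM S1 S2 S p q : (forall a b, S1 a -> S2 b -> S (a + b)%N) ->
  degs S1 p -> degs S2 q -> degs S (p * q).
Proof.
move=> SS Sp Sq m /msuppM_le /allpairsP[[m1 m2] [/= /Sp S1m /Sq S2m ->]].
by rewrite mdegD; apply: SS.
Qed.

Lemma degs_exp k S p j : degs (pred1 k) p -> S (k * j)%N -> degs S (p ^+ j).
Proof.
move=> Sp; suff: degs (pred1 (k * j)%N) (p ^+ j).
  by move=> Spj Skj; apply: degsW Spj => a /eqP->.
elim: j => [|j IH]; first by apply: degs1; rewrite muln0 /=.
rewrite exprS; apply: degsM Sp IH => a b /= /eqP-> /eqP->.
by rewrite mulnS.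
Qed.

Lemma degs_mderiv S T p i : (forall a, S a.+1 -> T a) ->
  degs S p -> degs T p^`M(i).
Proof.
move=> ST Sp m; rewrite mcoeff_msupp mcoeff_mderiv => nz.
apply: ST; have : (m + U_(i))%MM \in msupp p.
  by rewrite mcoeff_msupp; apply: contraNneq nz => ->; rewrite mul0rn.
by move/Sp; rewrite mdegD mdeg1 addn1.
Qed.

Lemma degs_homog d p : p \is d.-homog <-> degs (pred1 d) p.
Proof.
by split=> [/dhomogP h m /h /eqP|h]; last by apply/dhomogP=> m /h /eqP.
Qed.

Lemma degs_eq0 S p : degs S p -> (forall a, ~~ S a) -> p = 0.
Proof.
move=> Sp nS; apply: msuppnil0; case E: (msupp p) => [//|m s].
by have := Sp m; rewrite E mem_head => /(_ isT); rewrite (negbTE (nS _)).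
Qed.

Lemma degs_msize k p : degs (fun a => a < k)%N p <-> (msize p <= k)%N.
Proof.
split=> [h|h m mp]; last exact: leq_trans (msize_mdeg_lt mp) h.
rewrite msizeE big_seq; apply: (big_ind (fun j => j <= k)%N) => //.
by move=> a b; rewrite geq_max => ->.
Qed.

(* S a b reads: a product of a factors may have degree b. *)
Lemma degs_msub k (g : 'I_n -> {mpoly K[k]}) (S : rel nat) T1 T2 p :
  S 0%N 0%N ->
  (forall a b a' b', S a b -> S a' b' -> S (a + a')%N (b + b')%N) ->
  (forall i, degs (S 1%N) (g i)) ->
  (forall a b, T1 a -> S a b -> T2 b) -> degs T1 p -> degs T2 (msub g p).
Proof.
move=> S0 SD Sg ST T1p; rewrite /mmap big_seq.
apply: (big_ind (degs T2)) => [|p1 p2|m mp].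
- by move=> m; rewrite msupp0.
- by move=> h1 h2 m /msuppD_le; rewrite mem_cat => /orP[/h1|/h2].
move=> m'; rewrite mul_mpolyC => /msuppZ_le m'p.
apply: ST (T1p _ mp) _; move: m' m'p;
  suff: degs (S (mdeg m)) (\prod_(i < n) g i ^+ m i) by [].
rewrite mdegE; apply: (big_ind2 (fun a (q : {mpoly K[k]}) => degs (S a) q)) =>
  [m'|a q a' q' h1 h2 m'|i _].
- by rewrite msupp1 inE => /eqP->; rewrite mdeg0.
- by case/msuppM_le/allpairsP=> [[m1 m2] [/= /h1 S1m /h2 S2m ->]];
  rewrite mdegD SD.
elim: (m i) => [|j IH] m'.
  by rewrite expr0 msupp1 inE => /eqP->; rewrite mdeg0.
rewrite exprS => /msuppM_le/allpairsP[[m1 m2] [/= /Sg S1m /IH S2m ->]].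
by rewrite mdegD -add1n SD.
Qed.

End Degrees.

(** * Order at the origin and maps tangent to the identity *)

Lemma mulrBM (A : comPzRingType) (a b c d : A) :
  a * b - c * d = (a - c) * b + (b - d) * c.
Proof. by ring. Qed.

Section Order.
Variables (K : comNzRingType) (n : nat).
Implicit Types (p q : {mpoly K[n]}).

Definition tangent_id (G : 'I_n -> {mpoly K[n]}) : Prop :=
  forall i, degs (leq 2) (G i - 'X_i).

Lemma degs_leM a b p q :
  degs (leq a) p -> degs (leq b) q -> degs (leq (a + b)) (p * q).
Proof. by apply: degsM => c d; lia. Qed.

Lemma degs_leMr a p q : degs (leq a) p -> degs (leq a) (p * q).
Proof.
by move=> ap; rewrite -[a]addn0; apply: degs_leM => // m _.
Qed.

Lemma degs_coef0 p : degs (leq 1) p <-> p@_0%MM = 0.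
Proof.
split=> [h|h m].
  apply/eqP; rewrite mcoeff_eq0; apply/negP => /h; rewrite mdeg0 //.
rewrite lt0n mdeg_eq0 => mp; apply: contraTneq mp => ->.
by rewrite -mcoeff_eq0 h.
Qed.

Lemma tangent_id_ge1 G : tangent_id G -> forall i, degs (leq 1) (G i).
Proof.
move=> GT i; rewrite -[G i](subrK 'X_i); apply: degsD; last exact: degsXU.
by apply: degsW (GT i) => a; apply: ltnW.
Qed.

(** The lowest-degree part survives the substitution. The property [R] is multiplicative, so it
    passes from the variables to all monomials. *)
Lemma msub_tangent G a p :
  tangent_id G -> degs (leq a) p -> degs (leq a.+1) (msub G p - p).
Proof.
move=> GT ap.
pose R b q := degs (leq b) q /\ degs (leq b.+1) (msub G q - q).
have R0 : R 0%N 1.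
  by split; [exact: degs1 | rewrite rmorph1 subrr; exact: degs0].
have RM b q b' q' : R b q -> R b' q' -> R (b + b')%N (q * q').
  move=> [R1 R2] [R1' R2']; split; first exact: degs_leM.
  have -> : msub G (q * q') - q * q' =
     (msub G q - q) * (msub G q' - q') + q * (msub G q' - q') + (msub G q - q)
       * q'.
    by rewrite rmorphM /=; ring.
  apply: degsD; last by rewrite -addSn; apply: degs_leM.
  apply: degsD; last by rewrite -addnS; apply: degs_leM.
  by apply: degsW (degs_leM R2 R2') => c; lia.
have RX m : R (mdeg m) 'X_[m].
  rewrite mdegE mpolyXE_id.
  apply: (big_ind2 R) => [//||i _]; first by move=> ? ? ? ?; apply: RM.
  elim: (m i) => [|j IH]; first by rewrite expr0.
  rewrite exprS -add1n; apply: RM => //; split; first exact: degsXU.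
  by rewrite mmapXU; apply: GT.
have -> : msub G p - p = \sum_(m <- msupp p) p@_m *: (msub G 'X_[m] - 'X_[m]).
  rewrite {1 2}[p]mpolyE rmorph_sum -sumrB; apply: eq_bigr => m _.
  by rewrite /= mmapZ mul_mpolyC scalerBr.
rewrite big_seq; apply: degs_sum => m mp; apply: degsZ.
by apply: degsW (RX m).2 => c; apply: leq_ltn_trans; apply: ap.
Qed.

(** If [p(G) = 0], [msub_tangent] raises any lower bound on the order of [p] by one, so no monomial
    can occur in [p]. *)
Lemma msub_tangent_inj G p : tangent_id G -> msub G p = 0 -> p = 0.
Proof.
move=> GT Gp0; have ap a : degs (leq a) p.
  elim: a => [//|a IH]; have := msub_tangent GT IH.
  by rewrite Gp0 sub0r => /degsN; rewrite opprK.
apply: msuppnil0; case E: (msupp p) => [//|m s].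
have mp : m \in msupp p by rewrite E mem_head.
by have := ap (mdeg m).+1 m mp; rewrite ltnn.
Qed.

(* The substitution by G is injective, so its right inverse is two-sided. *)
Lemma msub_inv_sym F G : tangent_id G ->
  (forall i, msub G (F i) = 'X_i) -> forall i, msub F (G i) = 'X_i.
Proof.
move=> GT FG i; apply/eqP; rewrite -subr_eq0; apply/eqP.
apply: (msub_tangent_inj GT); rewrite rmorphB /= msub_comp mmapXU.
rewrite (eq_mmap (h' := fun i => 'X_i) _ FG (f' := @mpolyC n K)) //.
by rewrite msub_id subrr.
Qed.

Lemma msub_congr k N (h h' : 'I_k -> {mpoly K[n]}) (q : {mpoly K[k]}) :
  (forall i, degs (leq N) (h i - h' i)) -> degs (leq N) (msub h q - msub h' q).
Proof.
move=> hh; elim/mpoly_ind: q => [c|i|p q IHp IHq|p q IHp IHq].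
- by rewrite !mmapC subrr; apply: degs0.
- by rewrite !mmapXU.
- by rewrite !(mmapD _ _ p) opprD addrACA; apply: degsD.
by rewrite !rmorphM mulrBM; apply: degsD; apply: degs_leMr.
Qed.

Lemma mmap_scale_homog (S : comNzRingType) (f : {rmorphism K -> S}) s
    (h : 'I_n -> S) k p : degs (pred1 k) p ->
  mmap f (fun i => s * h i) p = s ^+ k * mmap f h p.
Proof.
move=> pk; rewrite /mmap mulr_sumr big_seq [RHS]big_seq; apply: eq_bigr => m mp.
have <- : mdeg m = k by apply/eqP/pk.
rewrite mulrCA; congr (_ * _); rewrite /mmap1 mdegE -prodrXr -big_split.
by apply: eq_bigr => i _; rewrite exprMn_comm //; apply: mulrC.
Qed.

End Order.

(** * Polynomial formal inverses *)

Section FormalInverse.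
Variables (K : comNzRingType) (n : nat).
Implicit Types (p q : {mpoly K[n]}) (F G : 'I_n -> {mpoly K[n]}).

Lemma truncate_mpoly N p : degs (leq N.+1) (p - truncate N (mseries_of_mpoly
  p)).
Proof.
move=> m; rewrite mcoeff_msupp mcoeffB; apply: contraNT; rewrite -leqNgt => mN.
by rewrite mcoeff_mpoly // subrr.
Qed.

(** As [F] has no constant term, truncating [p] and [F] at the degree [N] of [m] changes the
    composite only in degrees above [N]. *)
Lemma mseries_comp_mpoly p F (f : mseries K n) (g : 'I_n -> mseries K n) m :
  (forall i, degs (leq 1) (F i)) ->
  f =1 mseries_of_mpoly p -> (forall i, g i =1 mseries_of_mpoly (F i)) ->
  mseries_comp f g m = (msub F p)@_m.
Proof.
move=> F1 fp gF; rewrite /mseries_comp comp_mpoly_msub; set N := mdeg m.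
have eT h q : h =1 mseries_of_mpoly q ->
    truncate N h = truncate N (mseries_of_mpoly q).
  by move=> e; apply: eq_bigr => m' _; rewrite e.
rewrite (eT _ _ fp); set T := fun i => truncate N (g i).
apply/esym/eqP; rewrite -subr_eq0 -mcoeffB mcoeff_eq0; apply/negP => mp.
suff /(_ m mp): degs (leq N.+1)
    (msub F p - msub T (truncate N (mseries_of_mpoly p))) by rewrite ltnn.
rewrite -[X in X - _](subrK (msub F (truncate N (mseries_of_mpoly p)))) -addrA.
apply: degsD.
  rewrite -rmorphB; apply: (degs_msub (S := leq) (T1 := leq N.+1)) => //.
  - by move=> *; apply: leq_add.
  - by move=> a b; apply: leq_trans.
  - exact: truncate_mpoly.
by apply: msub_congr => i; rewrite /T (eT _ _ (gF i)); apply: truncate_mpoly.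
Qed.

(** Replaces the coefficientwise definition by polynomial identities, the form used from here on. *)
Lemma polynomial_formal_inverseP F : (forall i, degs (leq 1) (F i)) ->
  has_polynomial_formal_inverse F <->
  exists G, [/\ forall i, degs (leq 1) (G i), forall i, msub G (F i) = 'X_i
    & forall i, msub F (G i) = 'X_i].
Proof.
move=> F1; split=> [[g [[g0 FG GF] gp]]|[G [G1 FG GF]]]; last first.
  exists (fun i => mseries_of_mpoly (G i)); split; last by move=> i;
    exists (G i).
  split=> [i|i m|i m].
  - by rewrite /mseries_of_mpoly; apply/degs_coef0.
  - by rewrite (mseries_comp_mpoly (p := F i) m G1) // FG.
  by rewrite (mseries_comp_mpoly (p := G i) m F1) // GF.
have [G gG] : exists G : 'I_n -> {mpoly K[n]},
    forall i, g i =1 mseries_of_mpoly (G i).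
  by have [G gG] := fin_all_exists gp; exists G => i m; apply: gG.
have G1 i : degs (leq 1) (G i).
  by apply/degs_coef0; rewrite -(g0 i) gG.
exists G; split=> // i; apply/mpolyP => m.
  by rewrite -(mseries_comp_mpoly (f :=
    mseries_of_mpoly (F i)) m G1 _ gG) // FG.
by rewrite -(mseries_comp_mpoly (g := fun i =>
  mseries_of_mpoly (F i)) m F1 (gG i)) // GF.
Qed.

End FormalInverse.

(** * The degree bound for a polynomial inverse *)

Section LinearIndependence.
Variables (K : fieldType) (n : nat) (I : finType).

(** The coefficient matrix has trivial left kernel, so it has at least as many columns as rows. *)
Lemma free_family_card b (f : I -> {mpoly K[n]}) :
  (forall i, (msize (f i) <= b)%N) ->
  (forall v : I -> K, \sum_i v i *: f i = 0 -> forall i, v i = 0) ->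
  (#|I| <= #|{: 'X_{1..n < b}}|)%N.
Proof.
move=> fb free.
pose A : 'M[K]_(#|I|, #|{: 'X_{1..n < b}}|) :=
  \matrix_(r, s) (f (enum_val r))@_(enum_val s : 'X_{1..n < b}).
suff: row_free A by rewrite /row_free => /eqP <-; apply: rank_leq_col.
rewrite -kermx_eq0; apply/rowV0P => u /sub_kermxP uA0.
suff u0 i : u 0 (enum_rank i) = 0.
  by apply/rowP => r; rewrite mxE -[r]enum_valK u0.
move: i; apply: free; apply/mpolyP => m; rewrite mcoeff0 raddf_sum /=.
have [mb|bm] := ltnP (mdeg m) b; last first.
  apply: big1 => i _; rewrite mcoeffZ memN_msupp_eq0 ?mulr0 //.
  exact/msize_mdeg_ge/(leq_trans (fb i)).
have /rowP/(_ (enum_rank (BMultinom mb))) := uA0.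
rewrite !mxE (reindex _ (onW_bij _ (@enum_rank_bij I))) /= => e.
by rewrite -[RHS]e; apply: eq_bigr => i _; rewrite !mxE !enum_rankK mcoeffZ.
Qed.

(** In a vanishing combination, the largest leading monomial among the terms with nonzero
    coefficient occurs only once and cannot cancel. *)
Lemma mlead_inj_free (g : I -> {mpoly K[n]}) :
  (forall i, g i != 0) -> injective (fun i => mlead (g i)) ->
  forall v : I -> K, \sum_i v i *: g i = 0 -> forall i, v i = 0.
Proof.
move=> g0 inj v sum0 i0; apply/eqP/negPn/negP => vi0.
case: (@arg_maxP _ _ I i0 (fun i => v i != 0) (fun i => mlead (g i)) vi0) =>
  i vi imax.
have : (\sum_j v j *: g j)@_(mlead (g i)) = 0 by rewrite sum0 mcoeff0.
rewrite raddf_sum (bigD1 i) //= mcoeffZ big1 ?addr0 => [|j ji].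
  by move/eqP; rewrite mulf_eq0 (negbTE vi) mleadc_eq0 (negbTE (g0 i)).
rewrite mcoeffZ; have [->|vj] := eqVneq (v j) 0; first by rewrite mul0r.
have le_ji : (mlead (g j) <= mlead (g i))%O := imax j vj.
rewrite mcoeff_gt_mlead ?mulr0 // lt_neqAle le_ji andbT.
by apply: contra ji => /eqP/inj->.
Qed.

End LinearIndependence.

Section Count.
Variable n : nat.
Let c b := #|{: 'X_{1..n < b}}|.

Lemma card_bmultinom_gt0 b : (0 < b)%N -> (0 < c b)%N.
Proof.
by case: b => // b _; apply/card_gt0P; exists (@bm0 n b).
Qed.

(* A monomial is determined by the quotients and remainders of its exponents
   modulo D. *)
Lemma card_bmultinom_mul D b : (0 < D)%N -> (c (D * b) <= D ^ n * c b)%N.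
Proof.
case: D => // D _.
have qP (m : 'X_{1..n < D.+1 * b}) : (mdeg [multinom m i %/ D.+1 | i < n] <
  b)%N.
  rewrite -(ltn_pmul2l (ltn0Sn D)); apply: leq_ltn_trans (bmdeg m).
  rewrite !mdegE big_distrr /=; apply: leq_sum => i _.
  by rewrite mnmE mulnC leq_trunc_div.
pose h (m : 'X_{1..n < D.+1 * b}) : {ffun 'I_n -> 'I_D.+1} * 'X_{1..n < b} :=
  ([ffun i => inord (m i %% D.+1)], BMultinom (qP m)).
have hI : injective h.
  move=> m m' e; have /ffunP e1 := congr1 fst e.
have /(congr1 (@bmnm _ _)) e2 := congr1 snd e; apply/val_inj/mnmP => i /=.
  have := e1 i; rewrite !ffunE => /(congr1 val);
    rewrite /= !inordK ?ltn_pmod // => er.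
  have /mnmP/(_ i) := e2; rewrite !mnmE => e'.
by rewrite (divn_eq (m i) D.+1) er e' -divn_eq.
have := leq_card h hI.
by rewrite card_prod card_ffun !card_ord.
Qed.

(* Iterating the inequality makes c grow exponentially, which contradicts
   c (2 b) <= 2 ^ n * c b. *)
Lemma card_bmultinom_growth C e : (0 < C)%N -> (C < e)%N ->
  ~ (forall b, C.+1 * c b <= C * c (b + e))%N.
Proof.
move=> C0 Ce H.
have H1 k b : (C.+1 ^ k * c b <= C ^ k * c (b + k * e))%N.
  elim: k b => [|k IH] b; first by rewrite !expn0 mul0n addn0.
  have := leq_mul (leqnn C.+1) (IH b); rewrite mulnA -expnS => /leq_trans;
    apply.
  rewrite mulnCA expnSr -mulnA leq_pmul2l ?expn_gt0 ?C0 //.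
  by apply: leq_trans (H _) _;
    rewrite mulSn addnCA addnA [(_ + e)%N]addnC addnA.
(* The first two terms of the binomial expansion both equal [C ^ C]. *)
have two : (2 * C ^ C <= C.+1 ^ C)%N.
  rewrite -[C.+1]addn1 expnDn; case: (C) C0 => // k _.
  rewrite big_ord_recl big_ord_recl /= /bump /= bin0 mul1n subn0 exp1n muln1.
  rewrite addnA; apply: leq_trans (leq_addr _ _).
  by rewrite addn0 bin1 exp1n muln1 subSS subn0 -expnS mul2n addnn.
have H2 b : (2 * c b <= c (b + C * e))%N.
  have CC : (0 < C ^ C)%N by rewrite expn_gt0 C0.
  rewrite -(leq_pmul2l CC) mulnCA mulnA; apply: leq_trans (H1 C b).
  by rewrite leq_mul2r two orbT.
have H3 k b : (2 ^ k * c b <= c (b + k * (C * e)))%N.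
  elim: k b => [|k IH] b; first by rewrite expn0 mul1n mul0n addn0.
  rewrite expnSr -mulnA [in X in (_ <= X)%N]mulSn addnA;
    apply: leq_trans (IH _).
  by rewrite leq_pmul2l ?expn_gt0.
(* Starting from this [b], [n.+1] doublings end exactly at [2 b], so that
   [2 ^ n.+1 * c b <= c (2 b)]. *)
pose b := (n.+1 * (C * e))%N.
have b0 : (0 < b)%N by rewrite !muln_gt0 C0 (leq_ltn_trans _ Ce).
have := H3 n.+1 b; rewrite -/b addnn -mul2n => h.
have := leq_trans h (card_bmultinom_mul b (isT : 0 < 2)%N).
by rewrite leq_mul2r leq_exp2l // ltnn orbF; apply/negP;
  rewrite -lt0n card_bmultinom_gt0.
Qed.

End Count.

Lemma mnm_divn n (c : 'X_{1..n}) : c != 0%MM ->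
  forall a : 'X_{1..n}, exists a0 q, a = (a0 + c *+ q)%MM /\ ~~ (c <= a0)%MM.
Proof.
move=> c0 a; have [k] := ubnP (mdeg a); elim: k a => // k IH a ak.
have [ca|nca] := boolP (c <= a)%MM; last first.
  by exists a, 0%N; rewrite mulm0n addm0.
have dlt : (mdeg (a - c)%MM < k)%N.
  have := mdegD (a - c) c; rewrite submK // => e.
  have : (0 < mdeg c)%N by rewrite lt0n mdeg_eq0.
  by lia.
have [a0 [q [e ca0]]] := IH _ dlt; exists a0, q.+1; split => //.
by rewrite mulmSr addmA -e submK.
Qed.

(** If [q < q'], then [a = a' + c (q' - q)] would be divisible by [c]; by symmetry the quotients
    agree. *)
Lemma mnm_divn_inj n (c a a' : 'X_{1..n}) q q' :
  ~~ (c <= a)%MM -> ~~ (c <= a')%MM ->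
  (a + c *+ q = a' + c *+ q')%MM -> a = a' /\ q = q'.
Proof.
move=> ca ca' e.
suff aux (b b' : 'X_{1..n}) r r' : ~~ (c <= b)%MM ->
    (b + c *+ r = b' + c *+ r')%MM -> (r' <= r)%N.
  have qq : q = q' by apply/eqP;
    rewrite eqn_leq (aux _ _ _ _ ca e) (aux _ _ _ _ ca' (esym e)).
  by split=> //; move: e; rewrite qq => /addIm.
move=> cb eb; rewrite leqNgt; apply: contra cb => rr; apply/mnm_lepP => i.
by move/mnmP/(_ i): eb; rewrite !mnmDE !mulmnE; nia.
Qed.

Section DegreeBound.
Variables (K : fieldType) (n D : nat) (F G : 'I_n -> {mpoly K[n]}).

(* With x^c the leading monomial of G_j, the substitution by G sends
   F^a x_j^b to a polynomial with leading monomial x^(a + b c). *)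
Lemma degree_inverse_bound : (0 < n)%N -> (0 < D)%N ->
  (forall i, degs (fun a => a <= D)%N (F i)) ->
  (forall i, msub G (F i) = 'X_i) ->
  forall j, degs (fun a => a <= D ^ n.-1)%N (G j).
Proof.
move=> n0 D0 FD FG j; set C := (D ^ n.-1)%N.
have C0 : (0 < C)%N by rewrite expn_gt0 D0.
have [G0|G0] := eqVneq (G j) 0; first by rewrite G0; apply: degs0.
set c := mlead (G j); pose e := mdeg c.
suff eC : (e <= C)%N.
  by move=> m /msupp_le_mlead/lemc_mdeg h; apply: leq_trans h eC.
rewrite leqNgt; apply/negP => Ce.
have c0 : c != 0%MM by rewrite -mdeg_eq0 -lt0n (leq_ltn_trans _ Ce).
apply: (card_bmultinom_growth (n := n) C0 Ce) => b.
have De0 : (0 < D * e)%N by rewrite muln_gt0 D0 (leq_ltn_trans _ Ce).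
have /fin_all_exists[rq rqP] (a : 'X_{1..n < b}) : exists rq : 'X_{1..n} * nat,
    bmnm a = (rq.1 + c *+ rq.2)%MM /\ ~~ (c <= rq.1)%MM.
  by have [r [q h]] := mnm_divn c0 a; exists (r, q).
(* Write [a = a0 + c q]. Replacing [F^(c q)] by [x_j^(D e q)] keeps the degree bound [D |a|], and
   the leading monomial of the image under [G] recovers [a0], [q] and [i]. Each [a] thus yields
   [D e] independent polynomials of degree below [D (b + e)]. *)
pose f (ai : 'X_{1..n < b} * 'I_(D * e)) : {mpoly K[n]} :=
  msub F 'X_[(rq ai.1).1] * 'X_j ^+ (D * e * (rq ai.1).2 + ai.2).
pose g (ai : 'X_{1..n < b} * 'I_(D * e)) : {mpoly K[n]} :=
  'X_[(rq ai.1).1] * G j ^+ (D * e * (rq ai.1).2 + ai.2).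
have fg ai : msub G (f ai) = g ai.
  rewrite rmorphM rmorphXn /= msub_comp mmapXU; congr (_ * _).
  by rewrite (eq_mmap (f' := @mpolyC n K) _ FG) // msub_id.
have X0 (m : 'X_{1..n}) : 'X_[m] != 0 :> {mpoly K[n]}.
  by rewrite -msupp_eq0 msuppX.
have gl ai : mlead (g ai) =
    ((rq ai.1).1 + c *+ (D * e * (rq ai.1).2 + ai.2))%MM.
  by rewrite mleadM ?expf_neq0 // mleadXm mleadX.
have gI : injective (fun ai => mlead (g ai)).
  move=> [a i] [a' i']; rewrite !gl /= => /mnm_divn_inj.
  case: (rqP a) (rqP a') => ea ca [ea' ca'] /(_ ca ca') [e1 e2].
  have eq2 : (rq a).2 = (rq a').2.
    by move/(congr1 (divn^~ (D * e)%N)): e2;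
      rewrite !(mulnC (D * e)%N) !divnMDl // !divn_small // !addn0.
  have ei : i = i' by apply/val_inj; move: e2; rewrite eq2 => /addnI.
  by rewrite ei; congr (_, _); apply/val_inj; rewrite /= ea ea' e1 eq2.
have ffree (v : _ -> K) : \sum_ai v ai *: f ai = 0 -> forall ai, v ai = 0.
  move=> s0; apply: (mlead_inj_free _ gI) => [ai|];
    first by rewrite mulf_neq0 // expf_neq0.
  transitivity (msub G (\sum_ai v ai *: f ai)); last by rewrite s0 rmorph0.
  rewrite rmorph_sum; apply: eq_bigr => ai _.
  by rewrite /= mmapZ mul_mpolyC fg.
have fD ai : (msize (f ai) <= D * (b + e))%N.
  case: ai => a i; apply/degs_msize.
  have [ea _] := rqP a.
  have := bmdeg a; rewrite ea mdegD mdegMn -/e => lt.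
  have iD := ltn_ord i.
  apply: (degsM (S1 := fun k => (k <= D * mdeg (rq a).1)%N)
    (S2 := pred1 (D * e * (rq a).2 + i)%N)) => [k l h1 /eqP->||].
  - have h2 : (D * (mdeg (rq a).1 + e * (rq a).2).+1 <= D * b)%N by rewrite
    leq_mul2l lt orbT.
    nia.
  - apply: (degs_msub (S := fun k l => (l <= D * k)%N) (T1 :=
    pred1 (mdeg (rq a).1))).
    + by [].
    + by move=> *; rewrite mulnDr leq_add.
    + by move=> k; rewrite muln1; apply: FD.
    + by move=> k l /eqP->.
    + by apply: degsX => /=.
  - apply: (degs_exp (k := 1%N)); first by apply: degsXU.
    by rewrite mul1n /=.
(* With [N(b)] the number of monomials of degree below [b], the count reads
   [D e N(b) <= D^n N(b + e) = D C N(b + e)], and [C < e]. *)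
have := free_family_card fD ffree; rewrite card_prod card_ord => h1.
have := leq_trans h1 (card_bmultinom_mul n (b + e) D0).
have -> : (D ^ n = D * C)%N by rewrite /C -expnS prednK.
move: #|_| #|_| => c1 c2; rewrite -mulnA mulnCA leq_pmul2l // mulnC => h2.
by apply: leq_trans h2; rewrite leq_mul2r Ce orbT.
Qed.

End DegreeBound.

(** * Nilpotent matrices over a domain and derivatives of traces *)

Section Nilpotent.
Variable R : idomainType.

Lemma monic_dvd_Xn (p q : {poly R}) k :
  p \is monic -> p * q = 'X^k -> exists j, p = 'X^j.
Proof.
elim: k p q => [|k IH] p q pm pq.
  exists 0%N; have : p \is a GRing.unit.
    by apply/unitrPr; exists q; rewrite pq.
  rewrite poly_unitE => /andP[/eqP sp _]; rewrite (size1_polyC (eq_leq sp)).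
  by move/monicP: pm; rewrite lead_coefE sp => ->.
have /orP[|] : root p 0 || root q 0.
- by rewrite -rootM pq rootE hornerXn expr0n.
- move=> /factor_theorem[p1]; rewrite subr0 => e.
  have p1m : p1 \is monic by move: pm; rewrite e monicMr ?monicX.
  have p1q : p1 * q = 'X^k.
    by apply: (mulIf (negbT (polyX_eq0 R))); rewrite -exprSr -pq e; ring.
  by have [j e1] := IH p1 q p1m p1q; exists j.+1; rewrite e e1 exprSr.
move=> /factor_theorem[q1]; rewrite subr0 => e; apply: (IH p q1 pm).
by apply: (mulIf (negbT (polyX_eq0 R))); rewrite -exprSr -pq e; ring.
Qed.

(** In [X^r - A^r = (X - A) C] the left side is [X^r]; taking determinants, the characteristic
    polynomial divides a power of [X]. *)
Lemma nilpotent_char_poly n (A : 'M[R]_n) r : A ^+ r = 0 -> char_poly A = 'X^n.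
Proof.
move=> Ar; pose B := map_mx (@polyC R) A.
have Br : B ^+ r = 0.
  have e k : map_mx (@polyC R) (A ^+ k) = B ^+ k.
    by elim: k => [|k IH]; rewrite ?expr0 ?map_mx1 // !exprS map_mxM IH.
  by rewrite -e Ar map_mx0.
have cXB : GRing.comm ('X%:M : 'M[{poly R}]_n) B.
  by rewrite /GRing.comm -[LHS]/('X%:M *m B) -[RHS]/(B *m 'X%:M) scalar_mxC.
have := subrXX_comm r cXB; rewrite Br subr0.
set C := (X in _ * X); rewrite -[_ * C]/(_ *m C) => /(congr1 determinant).
rewrite det_mulmx -[X in X * _]/(char_poly A).
have -> : ('X%:M : 'M[{poly R}]_n) ^+ r = ('X^r)%:M.
  by elim: r {Ar Br C} => [|r IH]; rewrite ?expr0 // !exprS IH scalar_mxM.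
rewrite det_scalar -exprM => /esym/(monic_dvd_Xn (char_poly_monic A))[j e].
by have := size_char_poly A; rewrite e size_polyXn => -[->].
Qed.

Lemma nilpotent_mxtrace n (A : 'M[R]_n) r : A ^+ r = 0 -> \tr A = 0.
Proof.
case: n A => [|n] A Ar; first by rewrite /mxtrace big_ord0.
apply: oppr_inj; rewrite -char_poly_trace // (nilpotent_char_poly Ar) coefXn.
by rewrite oppr0 ltn_eqF.
Qed.

Lemma nilpotent_expn n (A : 'M[R]_n) r : A ^+ r = 0 -> A ^+ n = 0.
Proof.
case: n A => [|n] A Ar; first by apply/matrixP => -[].
have := Cayley_Hamilton A; rewrite (nilpotent_char_poly Ar).
by rewrite rmorphXn /= horner_mx_X.
Qed.

End Nilpotent.

Section TraceDerivation.
Variables (S : comNzRingType) (D : {additive S -> S}) (n : nat).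
Hypothesis DM : forall a b, D (a * b) = D a * b + a * D b.
Implicit Types A B : 'M[S]_n.

Lemma derivation_mulmx A B :
  map_mx D (A *m B) = map_mx D A *m B + A *m map_mx D B.
Proof.
apply/matrixP => i j; rewrite !mxE raddf_sum -big_split.
by apply: eq_bigr => k _; rewrite DM !mxE.
Qed.

(** The terms of the Leibniz rule have equal traces by cyclicity. The induction carries a left
    factor [A ^+ a], since each cyclic shift moves a factor there. *)
Lemma derivation_mxtrace_exp A k :
  D (\tr (A ^+ k.+1)) = \tr (A ^+ k *m map_mx D A) *+ k.+1.
Proof.
suff H a b : \tr (A ^+ a *m map_mx D (A ^+ b.+1)) =
    \tr (A ^+ (a + b) *m map_mx D A) *+ b.+1.
  have := H 0%N k; rewrite expr0 -[1]/(1%:M) mul1mx add0n => <-.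
  by rewrite /mxtrace raddf_sum; apply: eq_bigr => i _; rewrite mxE.
elim: b a => [|b IH] a; first by rewrite expr1 addn0.
rewrite exprSr -[_ * A]/(_ *m A) derivation_mulmx mulmxDr mxtraceD mulmxA.
rewrite mxtrace_mulC mulmxA mulmxA -[A *m A ^+ a]/(A * _) -exprS IH addSnnS.
by rewrite -[A ^+ a *m A ^+ _]/(_ * _) -exprD [in RHS]mulrSr.
Qed.

End TraceDerivation.

(** * Power series in t and the derivation along the flow *)

Section SeriesInT.
Variables (K : numFieldType) (n : nat).
Local Notation A := {mpoly K[n]}.
Implicit Types (f g h : {poly A}) (i j : 'I_n).

(* Power series in t = 'X are represented by polynomials modulo powers of t. *)
Definition eqmodt N f g : Prop := forall m, (m < N)%N -> f`_m = g`_m.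

Lemma eqmodtW N M f g : (M <= N)%N -> eqmodt N f g -> eqmodt M f g.
Proof. by move=> MN e m mM; apply: e; apply: leq_trans MN. Qed.

Lemma eqmodtD N f g f' g' :
  eqmodt N f f' -> eqmodt N g g' -> eqmodt N (f + g) (f' + g').
Proof. by move=> e e' m mN; rewrite !coefD e ?e'. Qed.

Lemma eqmodtM N f g f' g' :
  eqmodt N f f' -> eqmodt N g g' -> eqmodt N (f * g) (f' * g').
Proof.
move=> e e' m mN; rewrite !coefM; apply: eq_bigr => i _.
by rewrite e ?e' //; have := ltn_ord i; lia.
Qed.

Lemma eqmodt_sum N (I : Type) (r : seq I) (P : pred I) (F G : I -> {poly A}) :
  (forall x, P x -> eqmodt N (F x) (G x)) ->
  eqmodt N (\sum_(x <- r | P x) F x) (\sum_(x <- r | P x) G x).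
Proof.
by move=> FG; apply: (big_ind2 (eqmodt N)) => // *; apply: eqmodtD.
Qed.

Lemma eqmodtMn N f g k : eqmodt N f g -> eqmodt N (f *+ k) (g *+ k).
Proof. by move=> e m mN; rewrite !coefMn e. Qed.

Lemma mpoly_mulrnI k : injective (fun p : A => p *+ k.+1).
Proof.
move=> p q e; apply/mpolyP => m; move/(congr1 (mcoeff m)): e.
by rewrite !mcoeffMn => /eqP; rewrite eqrMn2r => /eqP.
Qed.

Lemma eqmodtMnI N f g k : eqmodt N (f *+ k.+1) (g *+ k.+1) -> eqmodt N f g.
Proof. by move=> e m /e; rewrite !coefMn => /mpoly_mulrnI. Qed.

Definition pderiv i f : {poly A} := map_poly (mderiv i) f.

HB.instance Definition _ i :=
  GRing.Additive.copy (pderiv i) (map_poly (mderiv i)).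

Lemma coef_pderiv i f m : (pderiv i f)`_m = (f`_m)^`M(i).
Proof. by rewrite coef_map. Qed.

Lemma pderivM i f g : pderiv i (f * g) = pderiv i f * g + f * pderiv i g.
Proof.
apply/polyP => m; rewrite coefD !coefM coef_pderiv coefM raddf_sum -big_split.
by apply: eq_bigr => k _; rewrite /= !coef_pderiv mderivM.
Qed.

Lemma pderivXn i f k : pderiv i (f ^+ k.+1) = f ^+ k * pderiv i f *+ k.+1.
Proof.
elim: k => [|k IH]; first by rewrite expr0 expr1 mul1r.
rewrite exprS pderivM IH [in RHS]mulrS mulrC; congr (_ + _).
by rewrite mulrnAr mulrA -exprS.
Qed.

Lemma pderivC i j f : pderiv i (pderiv j f) = pderiv j (pderiv i f).
Proof. by apply/polyP => m; rewrite !coef_pderiv mderiv_comm. Qed.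

Lemma pderiv_deriv i f : pderiv i f^`() = (pderiv i f)^`().
Proof.
by apply/polyP => m; rewrite coef_pderiv !coef_deriv coef_pderiv mderivMn.
Qed.

Lemma eqmodt_pderiv N i f g : eqmodt N f g ->
  eqmodt N (pderiv i f) (pderiv i g).
Proof. by move=> e m mN; rewrite !coef_pderiv e. Qed.

(* The derivative along the vector field d/dt - grad Q. *)
Definition flowD (Q f : {poly A}) : {poly A} :=
  f^`() - \sum_j pderiv j Q * pderiv j f.

Lemma flowD_is_additive Q : additive (flowD Q).
Proof.
move=> f g; rewrite /flowD derivB.
have -> : \sum_j pderiv j Q * pderiv j (f - g) =
  \sum_j pderiv j Q * pderiv j f - \sum_j pderiv j Q * pderiv j g.
  by rewrite -sumrB; apply: eq_bigr => j _; rewrite raddfB mulrBr.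
ring.
Qed.

HB.instance Definition _ Q :=
  GRing.isZmodMorphism.Build {poly A} {poly A} (flowD Q) (flowD_is_additive Q).

Lemma flowDM Q f g : flowD Q (f * g) = flowD Q f * g + f * flowD Q g.
Proof.
rewrite /flowD derivM mulrBl mulrBr mulr_suml mulr_sumr.
have -> : \sum_j pderiv j Q * pderiv j (f * g) =
  \sum_j pderiv j Q * pderiv j f * g + \sum_j f * (pderiv j Q * pderiv j g).
  rewrite -big_split; apply: eq_bigr => j _; rewrite pderivM /=; ring.
ring.
Qed.

(** The coefficient of [t^(m+1)] in [p k] is determined by coefficients of order at most [m] in
    [p k] and [p k.+1], which vanish by induction on [m]. Integrating [d/dt] gains one order over
    [N]. *)
Lemma flow_unique Q N (p : nat -> {poly A}) :
  (forall k, (p k)`_0 = 0) ->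
  (forall k, eqmodt N (flowD Q (p k)) (p k.+1 *+ k.+1)) ->
  forall k, eqmodt N.+1 (p k) 0.
Proof.
move=> p0 pD k m; elim/ltn_ind: m k => -[|m] IH k mN; rewrite coef0 ?p0 //.
have z l k' : (l <= m)%N -> (p k')`_l = 0.
  by move=> lm; rewrite IH ?coef0 //; lia.
have := pD k m mN; rewrite coefB coefMn z // mul0rn coef_deriv coef_sum.
rewrite big1 ?subr0 => [|j _].
  by rewrite -[RHS](mul0rn _ m.+1) => /mpoly_mulrnI.
rewrite coefM big1 // => l _; rewrite !coef_pderiv z ?leq_subr //.
by rewrite mderiv0 mulr0.
Qed.

End SeriesInT.

(** * The Hamilton-Jacobi equation and powers of the Laplacian *)

Section Burgers.
Variables (K : numFieldType) (n : nat).
Local Notation A := {mpoly K[n]}.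
Implicit Types (P : A) (Q f g : {poly A}) (i j : 'I_n).

Definition grad2 Q : {poly A} := \sum_j pderiv j Q ^+ 2.

(** The equation for [Q], doubled to avoid a division. Its gradient is the inviscid Burgers equation
    up to sign. *)
Definition burgers N Q : Prop := eqmodt N (Q^`() *+ 2) (grad2 Q).

Lemma eqmodt_grad2 N Q Q' : eqmodt N Q Q' -> eqmodt N (grad2 Q) (grad2 Q').
Proof.
by move=> e; apply: eqmodt_sum => j _; apply: eqmodtM; apply: eqmodt_pderiv.
Qed.

(** The equation determines each coefficient from those of lower order. The size bound matters when
    the later coefficients vanish: the truncation is then an exact solution. *)
Lemma burgers_exists P N :
  exists Q, [/\ Q`_0 = P, burgers N Q & (size Q <= N.+1)%N].
Proof.
elim: N => [|N [Q [Q0 QN sQ]]].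
  by exists P%:P; split; [rewrite coefC | move=> m | rewrite size_polyC leq_b1].
pose c : A := ((N.+1 * 2)%:R^-1)%R *: (grad2 Q)`_N.
pose Q' := Q + c *: 'X^(N.+1).
have QQ' : eqmodt N.+1 Q' Q.
  by move=> m mN; rewrite coefD coefZ coefXn ltn_eqF // mulr0 addr0.
exists Q'; split; first by rewrite QQ'.
  move=> m; rewrite ltnS leq_eqVlt => /orP[/eqP->|mN];
    rewrite (eqmodt_grad2 QQ') //.
    rewrite coefMn coef_deriv coefD coefZ coefXn eqxx mulr1 -mulrnA.
    rewrite (nth_default 0 sQ) add0r /c -scaler_nat scalerA divff ?scale1r //.
    by rewrite pnatr_eq0.
  by rewrite -QN // !coefMn !coef_deriv QQ'.
  by apply: leq_trans mN _.
rewrite (leq_trans (size_polyD _ _)) // geq_max (leq_trans sQ) //.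
by rewrite (leq_trans (size_scale_leq _ _)) // size_polyXn.
Qed.

Variables (N : nat) (Q : {poly A}).
Hypothesis QN : burgers N Q.

Lemma burgers_grad i :
  eqmodt N (pderiv i Q)^`() (\sum_j pderiv j Q * pderiv j (pderiv i Q)).
Proof.
apply: (@eqmodtMnI _ _ _ _ _ 1); have := eqmodt_pderiv i QN.
rewrite raddfMn /= pderiv_deriv.
suff -> : pderiv i (grad2 Q) =
  (\sum_j pderiv j Q * pderiv j (pderiv i Q)) *+ 2 by [].
rewrite -sumrMnl raddf_sum; apply: eq_bigr => j _.
by rewrite /= pderivXn expr1 (pderivC i).
Qed.

Lemma flowD_grad i : eqmodt N (flowD Q (pderiv i Q)) 0.
Proof. by move=> m mN; rewrite coefB burgers_grad // subrr coef0. Qed.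

Definition hessian_t : 'M[{poly A}]_n := \matrix_(i, j) pderiv i (pderiv j Q).

(** On differentiating the equation for [d_i Q] in [x_k], the third derivatives form the transport
    term of [D], the products of second derivatives form [M^2]. *)
Lemma flowD_hessian i k :
  eqmodt N (flowD Q (hessian_t i k)) ((hessian_t *m hessian_t) i k).
Proof.
have -> : hessian_t i k = pderiv k (pderiv i Q) by rewrite mxE pderivC.
move=> m mN; rewrite coefB -pderiv_deriv (eqmodt_pderiv k (burgers_grad i)) //
  raddf_sum /=.
apply/eqP; rewrite subr_eq -coefD mxE -big_split /=; apply/eqP.
congr (_ : {poly A})`_m; apply: eq_bigr => j _.
rewrite pderivM !mxE (pderivC k j (pderiv i Q)) (pderivC k j Q) (pderivC j i Q).
ring.
Qed.

(* The traces p_k of the powers of the Hessian M of Q satisfy D p_k = k p_(k+1),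
   because D M = M^2, and they vanish at t = 0. *)
Lemma burgers_harmonic : hessian_nilpotent Q`_0 ->
  eqmodt N.+1 (\sum_i pderiv i (pderiv i Q)) 0.
Proof.
move=> [r nil].
have -> : \sum_i pderiv i (pderiv i Q) = \tr (hessian_t ^+ 1).
  by rewrite expr1; apply: eq_bigr => i _; rewrite mxE.
apply: (@flow_unique _ _ Q N (fun k => \tr (hessian_t ^+ k.+1))) => k.
  (* At [t = 0] the matrix is the nilpotent Hessian of the initial value, whose positive powers have
     trace zero. *)
  have e l : map_mx (coefp 0) (hessian_t ^+ l) = hessian Q`_0 ^+ l.
    elim: l => [|l IH]; first by rewrite !expr0 map_mx1.
    rewrite !exprS map_mxM IH; congr (_ * _); apply/matrixP => i j.
    by rewrite !mxE /= !coef_pderiv mderiv_comm.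
  rewrite -[LHS]/(coefp 0 _) -(trace_map_mx (coefp 0)) e.
  by apply: (@nilpotent_mxtrace _ _ _ r); rewrite -exprM mulnC exprM nil expr0n.
move=> m mN.
have -> := derivation_mxtrace_exp (D := flowD Q) (@flowDM _ _ Q) hessian_t k.
rewrite !coefMn; congr (_ *+ _); rewrite [in RHS]exprSr [in RHS]exprSr -mulrA.
rewrite -[_ ^+ k * _]/(_ *m _) /mxtrace !coef_sum; apply: eq_bigr => i _.
rewrite !mxE !coef_sum; apply: eq_bigr => j _; move: m mN; apply: eqmodtM => //.
by move=> m mN; rewrite mxE flowD_hessian.
Qed.

Hypothesis HN : hessian_nilpotent Q`_0.

(* Q being harmonic, Delta(Q^(k+1)) = (k+1) k Q^(k-1) |grad Q|^2. *)
Lemma burgers_power k : eqmodt N ((Q ^+ k)^`() *+ (2 * k.+1))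
  (\sum_i pderiv i (pderiv i (Q ^+ k.+1))).
Proof.
have -> : \sum_i pderiv i (pderiv i (Q ^+ k.+1)) =
    (\sum_i pderiv i (pderiv i Q)) * Q ^+ k *+ k.+1 +
    Q ^+ k.-1 * grad2 Q *+ (k * k.+1).
  rewrite mulr_suml mulr_sumr -!sumrMnl -big_split; apply: eq_bigr => i _.
  rewrite pderivXn raddfMn /= pderivM mulrnDl addrC [_ * Q ^+ k]mulrC.
  congr (_ + _); case: k => [|k].
    by rewrite expr0 -[1]/(1%:P) [pderiv i 1%:P]map_polyC /= mderivC polyC0
      !mul0r mul0rn mul0n mulr0n.
  by rewrite pderivXn mulrnAl -mulrnA -mulrA -expr2.
have -> : (Q ^+ k)^`() *+ (2 * k.+1) =
    0 * Q ^+ k *+ k.+1 + Q ^+ k.-1 * (Q^`() *+ 2) *+ (k * k.+1).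
  rewrite deriv_exp mul0r mul0rn add0r mulrnAr -!mulrnA [_ * Q^`()]mulrC.
  by congr (_ *+ _); lia.
apply: eqmodtD; apply: eqmodtMn; apply: eqmodtM => //.
move=> m mN; symmetry; move: m mN; apply: eqmodtW (burgers_harmonic HN).
exact: leqnSn.
Qed.

(** Coefficients in [burgers_power] give [2 (m+1) (k+1) [t^(m+1)] Q^k = Delta [t^m] Q^(k+1)].
    Iteration trades each power of [t] for a Laplacian and one more factor [Q]. *)
Lemma burgers_coef_power m k : (m <= N)%N ->
  (Q ^+ k)`_m *+ (2 ^ m * m`! * (m + k)`!) =
  iter m (@laplacian K n) (Q`_0 ^+ (m + k)) *+ k`!.
Proof.
elim: m k => [|m IH] k mN.
  by rewrite expn0 fact0 !mul1n add0n /= -[LHS]/(coefp 0 (Q ^+ k) *+ _)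
    rmorphXn.
apply: (@mpoly_mulrnI _ _ k); have := burgers_power k mN.
have lapMn p l : laplacian (p *+ l) = laplacian p *+ l :> A.
  by rewrite /laplacian -sumrMnl; apply: eq_bigr => i _; rewrite !mderivMn.
have -> : (\sum_i pderiv i (pderiv i (Q ^+ k.+1)))`_m = laplacian (Q ^+
  k.+1)`_m.
  by rewrite coef_sum; apply: eq_bigr => i _; rewrite !coef_pderiv.
rewrite coefMn coef_deriv => /(congr1 (fun p : A =>
  p *+ (2 ^ m * m`! * (m + k.+1)`!))).
rewrite -lapMn IH; last exact: ltnW.
rewrite lapMn -addSnnS -!mulrnA factS => e.
rewrite iterS [X in _ = _ *+ X]mulnC -e; congr (_ *+ _).
by rewrite expnS !factS; ring.
Qed.

End Burgers.

(** * The map x + t grad Q *)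

Section GradientFlow.
Variables (K : numFieldType) (n N : nat) (Q : {poly {mpoly K[n]}}).
Local Notation A := {mpoly K[n]}.
Local Notation const := (@polyC A \o @mpolyC n K).
Hypothesis QN : burgers N Q.

Definition flow_map i : {poly A} := ('X_i)%:P + 'X * pderiv i Q.

Let ev := mmap const flow_map.

(** [D] sends [x_i] to [- d_i Q] and [t] to 1, and it kills [d_i Q], so the two contributions
    cancel. *)
Lemma flowD_flow_map i : eqmodt N (flowD Q (flow_map i)) 0.
Proof.
have pX j : pderiv j ('X : {poly A}) = 0.
  by apply/polyP => m; rewrite coef_pderiv coefX -mpolyC_nat mderivC coef0.
have DX : flowD Q 'X = 1.
  by rewrite /flowD derivX big1 ?subr0 // => j _; rewrite pX mulr0.
have DXi : flowD Q ('X_i)%:P = - pderiv i Q.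
  rewrite /flowD derivC sub0r (bigD1 i) //= big1 ?addr0 => [|j ji].
    by rewrite [pderiv i (polyC _)]map_polyC /= mderivXU eqxx mulr1.
  by rewrite [pderiv j (polyC _)]map_polyC /= mderivXU eq_sym (negbTE ji) mulr0.
rewrite raddfD /= DXi flowDM DX mul1r addKr -(mulr0 'X).
exact: eqmodtM (flowD_grad QN i).
Qed.

Lemma flow_map_coef0 p : (ev p)`_0 = p.
Proof.
rewrite -[LHS]/(coefp 0 (ev p)) /ev.
rewrite (rmorph_comp_mmap (g := @mpolyC n K)) => [|c /=]; last by rewrite coefC.
rewrite -[RHS]msub_id; apply: eq_mmap => // i /=.
by rewrite coefD coefC coefXM addr0.
Qed.

(* D annihilates the map x + t grad Q and grad Q itself, hence also
   (grad P)(x + t grad Q); the two sides agree at t = 0. *)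
Lemma flow_map_grad i : eqmodt N.+1 (ev (Q`_0)^`M(i)) (pderiv i Q).
Proof.
(* A single series killed by [D] becomes a sequence that is zero after its first term. *)
pose f k := if k is 0%N then ev (Q`_0)^`M(i) - pderiv i Q else 0.
suff /(_ 0%N) e : forall k, eqmodt N.+1 (f k) 0.
  by move=> m mN; apply/eqP; rewrite -subr_eq0 -coefB e // coef0.
apply: (@flow_unique _ _ Q) => -[|k] /=; rewrite ?coef0 //.
- by rewrite coefB flow_map_coef0 coef_pderiv subrr.
- rewrite mul0rn raddfB /=.
  suff e : eqmodt N (flowD Q (ev (Q`_0)^`M(i))) 0.
    by move=> m mN; rewrite coefB e // (flowD_grad QN) // coef0 subr0.
  have e := derivation_mmap (f := const) flow_map (@flowDM _ _ Q).
  rewrite [flowD Q _]e => [|c].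
    move=> m mN; rewrite coef0 coef_sum big1 // => j _.
    rewrite (eqmodtM (fun _ _ => erefl) (@flowD_flow_map j) mN).
    by rewrite mulr0 coef0.
  rewrite -[LHS]/(flowD Q (c%:MP)%:P) /flowD derivC sub0r big1 ?oppr0 // => j _.
  by rewrite [pderiv j (polyC _)]map_polyC /= mderivC polyC0 mulr0.
by rewrite raddf0 mul0rn.
Qed.

End GradientFlow.

(** * Coefficients of Q and the equivalence of (1) and (2) *)

Section Homogeneous.
Variables (K : numFieldType) (n : nat).
Implicit Types (p P : {mpoly K[n]}).

Lemma euler_homog d p : degs (pred1 d) p -> \sum_j p^`M(j) * 'X_j = p *+ d.
Proof.
move=> pd; rewrite {1 2}[p]mpolyE -sumrMnl.
under eq_bigr => j _ do rewrite raddf_sum mulr_suml.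
rewrite exchange_big big_seq [RHS]big_seq; apply: eq_bigr => m mp /=.
have <- : mdeg m = d by apply/eqP/pd.
rewrite mdegE -sumrMnr; apply: eq_bigr => j _.
rewrite mderivZ mderivX -!scalerAl scalerA -mpolyXD.
have [->|mj] := eqVneq (m j) 0%N; first by rewrite mulr0 scale0r mulr0n.
by rewrite submK ?lep1mP // mulr_natr scalerMnl.
Qed.

Lemma mderiv_eq0 p : (forall i, p^`M(i) = 0) -> degs (leq 1) p -> p = 0.
Proof.
move=> dp p1; apply/mpolyP => m; rewrite mcoeff0.
case: (pickP (fun i => m i != 0%N)) => [i mi|m0]; last first.
  suff -> : m = 0%MM by apply/degs_coef0.
  by apply/mnmP => i; rewrite mnm0E; apply/eqP/negbFE/m0.
have := mcoeff_mderiv i p (m - U_(i))%MM; rewrite dp mcoeff0.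
by rewrite submK ?lep1mP // => /esym/eqP; rewrite mulrn_eq0 => /eqP.
Qed.

Lemma degs_laplacian k p : degs (pred1 k) p ->
  degs (pred1 (k - 2)%N) (laplacian p).
Proof.
move=> pk; apply: degs_sum => i _; apply: (degs_mderiv (S := pred1 k.-1)).
  by move=> a /= /eqP; lia.
by apply: degs_mderiv pk => a /= /eqP; lia.
Qed.

Lemma degs_iter_laplacian m k p :
  degs (pred1 k) p -> degs (pred1 (k - m * 2)%N) (iter m (@laplacian K n) p).
Proof.
move=> pk; elim: m => [|m IH]; first by rewrite subn0.
by rewrite iterS mulSn addnC subnDA; apply: degs_laplacian.
Qed.

Lemma mpoly_mulrn_eq0 k p : p *+ k = 0 -> (0 < k)%N -> p = 0.
Proof. by case: k => // k e _; apply: (@mpoly_mulrnI _ _ k);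
  rewrite /= e mul0rn. Qed.

Section Coefficients.
Variables (P : {mpoly K[n]}) (N : nat) (Q : {poly {mpoly K[n]}}).
Hypotheses (HN : hessian_nilpotent P) (Q0 : Q`_0 = P) (QN : burgers N Q).

(** The integer factors in [burgers_coef_power] are nonzero, so vanishing of Laplacians becomes a
    bound on the degree of [Q^k] in [t]. *)
Lemma iter_laplacian_eq0 m k : (m <= N)%N ->
  iter m (@laplacian K n) (P ^+ (m + k)) = 0 <-> (Q ^+ k)`_m = 0.
Proof.
move=> mN; have HQ : hessian_nilpotent Q`_0 by rewrite Q0.
have := burgers_coef_power QN HQ k mN; rewrite Q0.
have c0 : (0 < 2 ^ m * m`! * (m + k)`!)%N by rewrite !muln_gt0 expn_gt0
  !fact_gt0.
move=> e; split=> z; move: e; rewrite z mul0rn.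
  by move/mpoly_mulrn_eq0; apply.
by move/esym/mpoly_mulrn_eq0; apply; apply: fact_gt0.
Qed.

Lemma burgers_coef_homog d m : P \is d.-homog -> (m <= N)%N ->
  degs (pred1 (d * m.+1 - m * 2)%N) Q`_m.
Proof.
move=> /degs_homog Pd mN; have HQ : hessian_nilpotent Q`_0 by rewrite Q0.
have := burgers_coef_power QN HQ 1 mN; rewrite Q0 expr1 -[1`!]/1%N mulr1n => e.
have c0 : (0 < 2 ^ m * m`! * (m + 1)`!)%N by rewrite !muln_gt0 expn_gt0
  !fact_gt0.
move=> a; rewrite mcoeff_msupp => nz.
suff /degs_iter_laplacian : degs (pred1 (d * m.+1)%N) (P ^+ m.+1).
  move=> /(_ m); rewrite -[m.+1]addn1 -e; apply.
  by rewrite mcoeff_msupp mcoeffMn mulrn_eq0 negb_or -lt0n c0.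
by apply: degs_exp Pd _; apply: eqxx.
Qed.

End Coefficients.

(** In each product of coefficients [l] of [Q] and [m - l] of the lower power, one index exceeds its
    bound. [a] may be negative, as [alpha] is for [n = 1]. *)
Lemma coef_exp_eq0 (Q : {poly {mpoly K[n]}}) N (a : rat) :
  (forall m, (m <= N)%N -> a < m%:R -> Q`_m = 0) ->
  forall k m, (m <= N)%N -> k.+1%:R * a < m%:R -> (Q ^+ k.+1)`_m = 0.
Proof.
move=> Qa; elim=> [|k IH] m mN; first by rewrite mul1r expr1; apply: Qa.
move=> am; rewrite exprS coefM big1 // => -[l /= lm] _.
have [al|la] := ltP a l%:R; first by rewrite Qa ?mul0r //; lia.
rewrite IH ?mulr0 //; first by lia.
rewrite natrB; last by lia.
by move: am la; rewrite (mulrSr 1 k.+1) mulrDl mul1r; lra.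
Qed.

Lemma vanishing_equiv d P : hessian_nilpotent P ->
  vanishing1 d P <-> vanishing2 d P.
Proof.
move=> HN; split=> V; last by move=> m am; apply: V; rewrite ?mul1r.
(* The order of [Q] is chosen after [m], just large enough to read the coefficient of [t^m]. *)
case=> // k _ m am; have [Q [Q0 QN _]] := burgers_exists P m.
apply/(iter_laplacian_eq0 HN Q0 QN) => //.
apply: (coef_exp_eq0 (N := m) _ (leqnn m) am) => l lm al.
have := iter_laplacian_eq0 HN Q0 QN 1 lm; rewrite expr1 => <-.
exact: (V l al).
Qed.

End Homogeneous.

(** * Vanishing and the inverse of x - grad P *)

Section GradientMaps.
Variables (K : numFieldType) (n : nat).
Local Notation A := {mpoly K[n]}.
Local Notation const := (@polyC A \o @mpolyC n K).
Implicit Types (P : A).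

(** When the Laplacians vanish from [M] on, [Q] is a polynomial in [t], and [x + t grad Q] can be
    evaluated at [t = 1]. *)
Lemma gradient_inverse d P M : (2 < d)%N -> P \is d.-homog ->
  hessian_nilpotent P ->
  (forall m, (M <= m)%N -> iter m (@laplacian K n) (P ^+ (m + 1)) = 0) ->
  exists G, [/\ forall i, degs (leq 1) (G i),
    forall i, msub G ('X_i - P^`M(i)) = 'X_i &
    forall i, msub (fun i => 'X_i - P^`M(i)) (G i) = 'X_i].
Proof.
move=> d2 Pd HN van; have [Q [Q0 QM sQ]] := burgers_exists P M.
have Qcoef N (Q' : {poly A}) m : Q'`_0 = P -> burgers N Q' -> (M <= m)%N ->
  (m <= N)%N ->
    Q'`_m = 0.
  move=> Q'0 Q'N Mm mN; rewrite -[Q']expr1.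
  by apply/(iter_laplacian_eq0 HN Q'0 Q'N) => //; apply: van.
(* [Q], built to order [M], solves the equation to every order: it equals the solution [Q'] to order
   [N], as the coefficients below [M] come from the same Laplacians and the others vanish. *)
have QN N : (M <= N)%N -> burgers N Q.
  move=> MN; have [Q' [Q'0 Q'N sQ']] := burgers_exists P N.
  suff -> : Q = Q' by [].
  apply/polyP => m; have [mM|Mm] := ltnP m M; last first.
    have [mN|Nm] := leqP m N; last first.
      rewrite !nth_default // ?(leq_trans sQ') //.
      by apply: leq_trans sQ _; apply: leq_ltn_trans Nm.
    rewrite (Qcoef N Q') //; have [mM|] := eqVneq m M.
      by rewrite mM (Qcoef M).
    by move=> ne; rewrite nth_default // (leq_trans sQ) // ltn_neqAle eq_sym ne.
  have HQ : hessian_nilpotent Q`_0 by rewrite Q0.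
  have HQ' : hessian_nilpotent Q'`_0 by rewrite Q'0.
  have := burgers_coef_power Q'N HQ' 1 (leq_trans (ltnW mM) MN).
  have := burgers_coef_power QM HQ 1 (ltnW mM).
  rewrite Q0 Q'0 !expr1 => <- /eqP;
    rewrite -subr_eq0 -mulrnBl => /eqP/mpoly_mulrn_eq0 e.
  apply/esym/eqP; rewrite -subr_eq0; apply/eqP/e.
  by rewrite !muln_gt0 expn_gt0 !fact_gt0.
pose phi : {rmorphism {poly A} -> A} := horner_eval 1.
pose G i := phi (flow_map Q i).
have GE i : G i = 'X_i + phi (pderiv i Q).
  by rewrite /G /flow_map rmorphD rmorphM /= /horner_eval hornerC hornerX mul1r.
have phiE p : phi (mmap const (flow_map Q) p) = msub G p.
  by apply: rmorph_comp_mmap => c /=; rewrite /horner_eval hornerC.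
have FG i : msub G ('X_i - P^`M(i)) = 'X_i.
  rewrite rmorphB /= mmapXU -phiE.
  suff -> : mmap const (flow_map Q) P^`M(i) = pderiv i Q by rewrite GE addrK.
  apply/polyP => m; rewrite -Q0; apply: (flow_map_grad (QN (maxn M m) _)).
    exact: leq_maxl.
  by rewrite ltnS leq_maxr.
(* The coefficient of [t^m] in [Q] has degree [d (m + 1) - 2 m >= 3], so its gradient has order at
   least 2. *)
have GT : tangent_id G.
  move=> i; rewrite GE addrAC subrr add0r /phi /= /horner_eval horner_coef.
  apply: degs_sum => m _; rewrite expr1n mulr1 coef_pderiv.
  have [mM|Mm] := leqP m M; last first.
    by rewrite nth_default ?mderiv0; [apply: degs0 | apply: leq_trans sQ Mm].
  apply: degs_mderiv (burgers_coef_homog HN Q0 QM Pd mM) => a /=.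
  by move=> /eqP; nia.
exists G; split=> //; first exact: tangent_id_ge1.
exact: msub_inv_sym.
Qed.

Lemma eqmodt_mmap N (h h' : 'I_n -> {poly A}) p :
  (forall i, eqmodt N (h i) (h' i)) ->
  eqmodt N (mmap const h p) (mmap const h' p).
Proof.
move=> hh; elim/mpoly_ind: p => [c|i|p q IHp IHq|p q IHp IHq].
- by rewrite !mmapC.
- by rewrite !mmapXU.
- have D u : mmap const u (p + q) = mmap const u p + mmap const u q.
    exact: mmapD.
  by rewrite !D; apply: eqmodtD.
have M u : mmap const u (p * q) = mmap const u p * mmap const u q.
  exact: (rmorphM (mmap const u)).
by rewrite !M; apply: eqmodtM.
Qed.

(* The inverse G satisfies G(s x) = s Gamma(s^(d-2)) for Gamma = x + t grad Q,
   so that the coefficients of Gamma are homogeneous components of G. *)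
Lemma inverse_degree_vanishing d P (G : 'I_n -> A) e : (2 < d)%N ->
  P \is d.-homog -> hessian_nilpotent P ->
  (forall i, msub (fun i => 'X_i - P^`M(i)) (G i) = 'X_i) ->
  (forall i, degs (fun a => a <= e)%N (G i)) ->
  forall m, (e < 1 + (d - 2) * m.+1)%N ->
    iter m (@laplacian K n) (P ^+ (m + 1)) = 0.
Proof.
move=> d2 Pd HN GF Ge m em; have [Q [Q0 QN sQ]] := burgers_exists P m.
have d0 : (0 < d - 2)%N by rewrite subn_gt0.
apply/(iter_laplacian_eq0 HN Q0 QN) => //; rewrite expr1.
have Qm := burgers_coef_homog HN Q0 QN Pd (leqnn m).
(* The coefficient is homogeneous of positive degree, so its gradient decides. *)
apply: mderiv_eq0 => [i|]; last by apply: degsW Qm => a /=; move=> /eqP; nia.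
pose psi : {rmorphism {poly A} -> {poly A}} := comp_poly 'X^(d - 2).
pose Gam i := 'X * psi (flow_map Q i).
pose Q' i := mmap const (flow_map Q) P^`M(i).
have GamF j : mmap const Gam ('X_j - P^`M(j)) =
    'X * psi (flow_map Q j - 'X * Q' j).
  rewrite rmorphB /= mmapXU (@mmap_scale_homog _ _ _ const 'X _ d.-1);
    last first.
    by move/degs_homog: Pd; apply: degs_mderiv => a /=; lia.
  have -> : mmap const (fun i => psi (flow_map Q i)) P^`M(j) = psi (Q' j).
    by symmetry; apply: rmorph_comp_mmap => c /=; rewrite /psi /= comp_polyC.
  rewrite /psi !rmorphB /= !rmorphM /= comp_polyX mulrBr mulrA -exprS.
  by congr (_ - 'X^_ * _); lia.
(* With [F = x - grad P] and [t = s^(d-2)], the relation [Gamma - t grad P(Gamma) = x] modulo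
   [t^(m+2)], multiplied by [s], becomes [F(s Gamma) = s x]. *)
have psimod j : eqmodt (1 + (d - 2) * m.+2)
    (mmap const Gam ('X_j - P^`M(j))) ('X * ('X_j)%:P).
  move=> l; rewrite GamF !coefXM; case: l => //= l lt.
  rewrite coef_comp_poly_Xn // coefC; case: ifP => [dl|];
    last by case: l {lt} => //; rewrite dvdn0.
  have lt2 : (l %/ (d - 2) < m.+2)%N by rewrite ltn_divLR // mulnC; lia.
  rewrite /flow_map coefB coefD !coefXM coefC.
  have -> : ((l == 0) = (l %/ (d - 2) == 0))%N.
    by move/dvdnP: dl => [q ->]; rewrite mulnK // muln_eq0 (gtn_eqF d0) orbF.
  case: (l %/ (d - 2))%N lt2 => [|l'] /= lt2; first by rewrite addr0 subr0.
  by rewrite /Q' -Q0 (flow_map_grad QN) // add0r subrr.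
(* Applying [G] gives [s Gamma = G(s x)] to this order, and the right side has degree at most [e] in
   [s]. *)
have Gam0 : (Gam i)`_(1 + (d - 2) * m.+1) = 0.
  rewrite -(mmapXU const Gam) -GF mmap_msub (eqmodt_mmap (G i) psimod);
    last by lia.
  rewrite /mmap coef_sum big_seq big1 // => a /Ge ae.
  have -> : mmap1 (fun j => 'X * ('X_j)%:P) a =
      'X^(mdeg a) * (mmap1 (fun j => 'X_j) a)%:P :> {poly A}.
    rewrite /mmap1 mdegE -prodrXr rmorph_prod -big_split; apply: eq_bigr => j _.
    by rewrite exprMn rmorphXn.
  rewrite mulrCA coefXnM; case: ltnP => // _ /=; rewrite coefCM coefC.
  by rewrite subn_eq0 leqNgt (leq_ltn_trans ae em) mulr0.
move: Gam0; rewrite coefXM /= coef_comp_poly_Xn // dvdn_mulr // mulKn //.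
by rewrite coefD coefC coefXM /= add0r coef_pderiv.
Qed.

(** For [d = 2] the Hessian [H] is constant. From [grad Q = H (x + t grad Q)], the coefficient of
    [t^l] in [grad Q] is [H^(l+1) x], and [H^n = 0]. *)
Lemma quadratic_vanishing P : P \is 2.-homog -> hessian_nilpotent P ->
  forall m, (n <= m.+1)%N -> iter m (@laplacian K n) (P ^+ (m + 1)) = 0.
Proof.
move=> P2 HN m nm; have [Q [Q0 QN sQ]] := burgers_exists P m.
apply/(iter_laplacian_eq0 HN Q0 QN) => //; rewrite expr1.
have Qm := burgers_coef_homog HN Q0 QN P2 (leqnn m).
apply: mderiv_eq0 => [i|]; last by apply: degsW Qm => a /=; move=> /eqP; lia.
pose H := hessian P; pose x : 'cV[A]_n := \col_j 'X_j.
have Pgrad j : degs (pred1 1%N) P^`M(j).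
  by move/degs_homog: P2; apply: degs_mderiv => a /=; lia.
have PE j : P^`M(j) = \sum_k H j k * 'X_k.
  by rewrite -[LHS]mulr1n -(euler_homog (Pgrad j)); apply: eq_bigr => k _;
    rewrite mxE.
have HC j k : exists c, H j k = c%:MP.
  exists (H j k)@_0%MM; apply: msize1_polyC; apply/degs_msize; rewrite mxE.
  by apply: degs_mderiv (Pgrad j) => a /=; lia.
suff col l : (l <= m)%N -> (\col_j (Q`_l)^`M(j)) = H ^+ l.+1 *m x.
  have [r nil] := HN; have Hn : H ^+ m.+1 = 0.
    by rewrite -(subnK nm) exprD (nilpotent_expn nil) mulr0.
  by have /matrixP/(_ i 0) := col m (leqnn m); rewrite Hn mul0mx !mxE.
elim: l => [|l IH] lm.
  by apply/matrixP => j k; rewrite Q0 expr1 mxE PE mxE; apply: eq_bigr => k' _;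
    rewrite [x _ _]mxE.
rewrite exprS -[H * _]/(H *m _) -mulmxA -IH; last exact: ltnW.
apply/matrixP => j k; rewrite mxE [RHS]mxE -coef_pderiv -(flow_map_grad QN j)
  // Q0 PE.
rewrite raddf_sum coef_sum; apply: eq_bigr => k' _;
  rewrite [RHS]/= [X in _ = _ * X]mxE.
have [c ->] := HC j k';
  have ev1 : mmap const (flow_map Q) (c%:MP * 'X_k') = (c%:MP)%:P * flow_map Q
  k'.
  by rewrite rmorphM /= mmapC mmapXU.
rewrite [LHS](congr1 (fun f : {poly A} => f`_l.+1) ev1).
by rewrite coefCM coefD coefC coefXM /= add0r coef_pderiv.
Qed.

End GradientMaps.

(** * Keller maps and polynomial left inverses *)

Section Keller.
Variable K : fieldType.

Definition left_invertible n (F : 'I_n -> {mpoly K[n]}) : Prop :=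
  exists G : 'I_n -> {mpoly K[n]}, forall i, msub F (G i) = 'X_i.

(** An inverse matrix in place of determinant 1: it can be exhibited blockwise and is stable under
    composition. *)
Definition keller n (F : 'I_n -> {mpoly K[n]}) : Prop :=
  exists B, jacobian F *m B = 1%:M.

Lemma eq_keller n (F G : 'I_n -> {mpoly K[n]}) : F =1 G -> keller F -> keller G.
Proof.
move=> FG [B FB]; exists B; rewrite -FB; congr (_ *m _).
by apply/matrixP => i j; rewrite !mxE FG.
Qed.

Lemma jacobian_msub n (F G : 'I_n -> {mpoly K[n]}) :
  jacobian (fun i => msub G (F i)) = map_mx (msub G) (jacobian F) *m jacobian G.
Proof.
apply/matrixP => i j; rewrite !mxE mderiv_msub; apply: eq_bigr => k _.
by rewrite !mxE.
Qed.

Lemma keller_comp n (F G : 'I_n -> {mpoly K[n]}) :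
  keller F -> keller G -> keller (fun i => msub G (F i)).
Proof.
move=> [B FB] [C GC]; exists (C *m map_mx (msub G) B).
rewrite jacobian_msub -mulmxA (mulmxA (jacobian G)) GC mul1mx.
by rewrite -map_mxM FB map_mx1.
Qed.

Lemma keller_automorphism n (F G : 'I_n -> {mpoly K[n]}) :
  (forall i, msub G (F i) = 'X_i) -> (forall i, msub F (G i) = 'X_i) ->
    keller F.
Proof.
move=> FG GF; exists (map_mx (msub F) (jacobian G)).
have J1 : map_mx (msub G) (jacobian F) *m jacobian G = 1%:M.
  rewrite -jacobian_msub; apply/matrixP => i j.
  by rewrite !mxE FG mderivXU eq_sym.
have := congr1 (map_mx (msub F)) J1; rewrite map_mxM map_mx1 => <-.
 congr (_ *m _); apply/matrixP => i j; rewrite !mxE /= msub_comp.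
rewrite (eq_mmap (f' := @mpolyC n K) (h' := fun i => 'X_i)) // ?msub_id //.
Qed.

(** The Jacobian matrix is block triangular with an identity block outside [a]. [C] is its inverse,
    with off-diagonal block [- B J], where [J] is that of the Jacobian matrix. *)
Lemma keller_triangular n (a : pred 'I_n) (F : 'I_n -> {mpoly K[n]})
    (B : 'I_n -> 'I_n -> {mpoly K[n]}) :
  (forall k, ~~ a k -> F k = 'X_k) ->
  (forall i j, a i -> a j ->
     \sum_(k | a k) (F i)^`M(k) * B k j = (i == j)%:R) ->
  keller F.
Proof.
move=> Fa FB.
pose C : 'M[{mpoly K[n]}]_n := \matrix_(k, j)
  if a j then (if a k then B k j else 0)
  else if a k then - \sum_(l | a l) B k l * (F l)^`M(j) else (k == j)%:R.
exists C; apply/matrixP => i j; rewrite !mxE.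
under eq_bigr => k _ do rewrite !mxE.
have [ai|nai] := boolP (a i); last first.
  rewrite Fa // (bigD1 i) //= mderivXU eqxx mul1r (negbTE nai) big1 ?addr0.
    by have [aj|//] := ifP; case: eqP => // ij; rewrite ij aj in nai.
  by move=> k ki; rewrite mderivXU eq_sym (negbTE ki) mul0r.
rewrite (bigID a) /=; have [aj|naj] := boolP (a j).
  rewrite [X in _ + X]big1 ?addr0 => [|k /negbTE-> ]; last by rewrite mulr0.
  by rewrite -FB //; apply: eq_bigr => k ->.
rewrite [X in _ + X](bigD1 j) //= (negbTE naj) eqxx mulr1 [X in _ + (_ +
  X)]big1.
  rewrite addr0.
  have -> : \sum_(k | a k) (F i)^`M(k) *
      (if a k then - \sum_(l | a l) B k l * (F l)^`M(j) else (k == j)%:R) =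
    - \sum_(l | a l) (\sum_(k | a k) (F i)^`M(k) * B k l) * (F l)^`M(j).
    rewrite -sumrN; under [RHS]eq_bigr => l _ do rewrite mulr_suml -sumrN.
    rewrite [RHS]exchange_big; apply: eq_bigr => k ->.
    by rewrite mulrN mulr_sumr -sumrN; apply: eq_bigr => l _; rewrite mulrA.
  rewrite (bigD1 i) //= FB // eqxx mul1r big1 ?addr0 => [|l /andP[al li]].
    by rewrite addNr; case: eqP => // ij; rewrite ij (negbTE naj) in ai.
  by rewrite FB // eq_sym (negbTE li) mul0r.
by move=> k /andP[/negbTE-> /negbTE->]; rewrite mulr0.
Qed.

(** As maps, [Fh = E1 o F o E2]; then [E2 o Phi o E1] is a left inverse of [F], after cancelling
    [E2] on the right. *)
Lemma left_invertible_conj n (E1 F E2 E2' Fh : 'I_n -> {mpoly K[n]}) :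
  (forall i, Fh i = msub E2 (msub F (E1 i))) ->
  (forall i, msub E2' (E2 i) = 'X_i) -> left_invertible Fh -> left_invertible F.
Proof.
move=> FhE E2K [Phi FhPhi].
have E2I : cancel (msub E2) (msub E2').
  move=> p; rewrite msub_comp.
  by rewrite (eq_mmap (f' := @mpolyC n K) (h' := fun i => 'X_i)) // msub_id.
have FhM p : msub Fh p = msub E2 (msub F (msub E1 p)).
  by rewrite !msub_comp; apply: eq_mmap => // i; rewrite FhE msub_comp.
exists (fun k => msub E1 (msub Phi (E2 k))) => k; apply: (can_inj E2I).
rewrite -FhM msub_comp mmapXU.
by rewrite (eq_mmap (f' := @mpolyC n K) (h' := fun i => 'X_i)) // msub_id.
Qed.

(** As maps, [s o pi = id] and [Fh o pi = pi o F]; hence [s o Phi o pi] is a left inverse of [F]. *)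
Lemma left_invertible_retract n N (F : 'I_n -> {mpoly K[n]})
    (Fh : 'I_N -> {mpoly K[N]}) (pi : 'I_N -> {mpoly K[n]})
    (s : 'I_n -> {mpoly K[N]}) :
  (forall i, msub pi (s i) = 'X_i) ->
  (forall k, msub pi (Fh k) = msub F (pi k)) ->
  left_invertible Fh -> left_invertible F.
Proof.
move=> pis piF [Phi FhPhi]; exists (fun i => msub pi (msub Phi (s i))) => i.
rewrite !msub_comp -(pis i) -[in RHS](msub_id (s i)) msub_comp.
apply: eq_mmap => // k /=; rewrite mmapXU -[RHS](mmapXU (@mpolyC n K)) -FhPhi.
by rewrite !msub_comp; apply: eq_mmap => // l; rewrite piF.
Qed.

End Keller.

(** * Variables indexed by finite types and block maps *)

Section FinTypeVariables.
Variables (K : fieldType) (T : finType).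
Local Notation MP := {mpoly K[#|T|]}.

Definition var (t : T) : MP := 'X_(enum_rank t).

Lemma msub_var k (g : T -> {mpoly K[k]}) t : msub (g \o enum_val) (var t) = g t.
Proof. by rewrite /var mmapXU /= enum_rankK. Qed.

Lemma var_enum_val (k : 'I_#|T|) : var (enum_val k) = 'X_k.
Proof. by rewrite /var enum_valK. Qed.

Lemma mderiv_var s t : (var s)^`M(enum_rank t) = (s == t)%:R.
Proof. by rewrite /var mderivXU (inj_eq enum_rank_inj). Qed.

Lemma keller_triangular_fin (a : pred T) (F : T -> MP) (B : T -> T -> MP) :
  (forall t, ~~ a t -> F t = var t) ->
  (forall i j, a i -> a j ->
     \sum_(t | a t) (F i)^`M(enum_rank t) * B t j = (i == j)%:R) ->
  keller (F \o enum_val).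
Proof.
move=> Fa FB; apply: (@keller_triangular _ _ (a \o enum_val) _
  (fun k l => B (enum_val k) (enum_val l))) => [k /Fa e|i j ai aj] /=.
  by rewrite e var_enum_val.
rewrite (reindex _ (onW_bij _ (@enum_rank_bij T))) /=.
under eq_bigl => t do rewrite enum_rankK.
under eq_bigr => t _ do rewrite enum_rankK.
by rewrite FB // (inj_eq enum_val_inj).
Qed.

End FinTypeVariables.

Arguments var K {T} t.

Section Blocks.
Variables (K : fieldType) (U W : finType).
Local Notation MP := {mpoly K[#|{: U + W}|]}.

Lemma keller_left_block (F : U + W -> MP) (B : U -> U -> MP) :
  (forall w, F (inr w) = var K (inr w)) ->
  (forall i j, \sum_k (F (inl i))^`M(enum_rank (inl k : U + W)) * B k j = (i ==
    j)%:R) ->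
  keller (F \o enum_val).
Proof.
move=> FW FB; apply: (@keller_triangular_fin _ _ (fun t =>
  if t is inl _ then true else false)
  _ (fun s t => if (s, t) is (inl u, inl v) then B u v else 0)) => [[]//|].
move=> [i|//] [j|//] _ _; rewrite big_sumType /= [X in _ + X]big_pred0 // addr0.
exact: FB.
Qed.

Lemma keller_right_block (F : U + W -> MP) (B : W -> W -> MP) :
  (forall u, F (inl u) = var K (inl u)) ->
  (forall i j, \sum_k (F (inr i))^`M(enum_rank (inr k : U + W)) * B k j = (i ==
    j)%:R) ->
  keller (F \o enum_val).
Proof.
move=> FW FB; apply: (@keller_triangular_fin _ _ (fun t =>
  if t is inr _ then true else false)
  _ (fun s t => if (s, t) is (inr u, inr v) then B u v else 0)) => [[]//|].
move=> [//|i] [//|j] _ _; rewrite big_sumType /= [X in X + _]big_pred0 // add0r.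
exact: FB.
Qed.

End Blocks.

Section Extension.
Variables (K : fieldType) (n : nat) (W : finType).
Local Notation T := ('I_n + W)%type.
Local Notation MP := {mpoly K[#|{: T}|]}.

Definition inl_var (i : 'I_n) : MP := var K (inl i).

Lemma mderiv_msub_inl p k :
  (msub inl_var p)^`M(enum_rank (inl k : T)) = msub inl_var p^`M(k).
Proof.
rewrite mderiv_msub (bigD1 k) //= mderiv_var eqxx mulr1 big1 ?addr0 // => i ik.
by rewrite mderiv_var; case: eqP => [[e]|_]; rewrite ?mulr0 // e eqxx in ik *.
Qed.

Lemma mderiv_msub_inr p w : (msub inl_var p)^`M(enum_rank (inr w : T)) = 0.
Proof. by rewrite mderiv_msub big1 // => i _; rewrite mderiv_var mulr0. Qed.

Lemma msub_inl k (g : T -> {mpoly K[k]}) p :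
  msub (g \o enum_val) (msub inl_var p) = msub (fun i => g (inl i)) p.
Proof. by rewrite msub_comp; apply: eq_mmap => // i; rewrite msub_var. Qed.

Definition extension (F : 'I_n -> {mpoly K[n]}) (t : T) : MP :=
  match t with inl i => msub inl_var (F i) | inr w => var K (inr w) end.

Lemma keller_extension F : keller F -> keller (extension F \o enum_val).
Proof.
move=> [B FB]; apply: (@keller_left_block _ _ _ _ (fun i j =>
  msub inl_var (B i j))) => //.
move=> i j; rewrite -[RHS](rmorph_nat (msub inl_var)).
have /matrixP/(_ i j) := FB; rewrite !mxE => <-; rewrite rmorph_sum.
by apply: eq_bigr => k _; rewrite /= mderiv_msub_inl rmorphM mxE.
Qed.

(** [Fh] preserves the graph [w = c(x)] and acts on it as [F]. *)
Lemma left_invertible_block F (c : W -> {mpoly K[n]}) (Fh : T -> MP) :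
  let pi t := match t with inl i => 'X_i | inr w => c w end in
  (forall t, msub (pi \o enum_val) (Fh t) = msub F (pi t)) ->
  left_invertible (Fh \o enum_val) -> left_invertible F.
Proof.
move=> pi piF; apply: (@left_invertible_retract _ _ _ _ _ (pi \o enum_val)
  inl_var).
  by move=> i; rewrite msub_var.
by move=> k; apply: piF.
Qed.

End Extension.

(** * Reduction of the degree to 3 *)

Section Decompositions.
Variables (K : fieldType) (n : nat).
Implicit Types (p : {mpoly K[n]}) (S : pred nat).

Lemma degs_split S (T : pred nat) p : degs S p ->
  exists p1 p2, [/\ p = p1 + p2, degs (predI S T) p1 & degs (predD S T) p2].
Proof.
move=> Sp; exists (\sum_(m <- msupp p | T (mdeg m)) p@_m *: 'X_[m]).
exists (\sum_(m <- msupp p | ~~ T (mdeg m)) p@_m *: 'X_[m]); split.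
- by rewrite {1}[p]mpolyE (bigID (fun m => T (mdeg m))).
- rewrite big_seq_cond; apply: degs_sum => m /andP[mp Tm]; apply: degsZ.
  by apply: degsX; rewrite /= Sp.
rewrite big_seq_cond; apply: degs_sum => m /andP[mp Tm]; apply: degsZ.
by apply: degsX; apply/andP; split=> //; apply: Sp.
Qed.

(** Each monomial is divisible by some [x_i x_k], and its cofactor goes into the entry [(i, k)]. *)
Lemma quadratic_factor S (T : pred nat) p : (forall a, S a ->
  (1 < a)%N /\ T (a - 2)%N) ->
  degs S p -> exists B : 'I_n * 'I_n -> {mpoly K[n]},
    p = \sum_j 'X_(j.1) * 'X_(j.2) * B j /\ (forall j, degs T (B j)).
Proof.
move=> ST Sp.
suff [B BE BT] : exists2 B : 'I_n * 'I_n -> {mpoly K[n]},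
    p = \sum_j 'X_(j.1) * 'X_(j.2) * B j & forall j, degs T (B j) by exists B.
rewrite [p]mpolyE big_seq; apply: (big_ind (fun q =>
  exists2 B : 'I_n * 'I_n -> {mpoly K[n]},
    q = \sum_j 'X_(j.1) * 'X_(j.2) * B j & forall j, degs T (B j))).
- exists (fun=> 0) => [|j]; last exact: degs0.
  by rewrite big1 // => j _; rewrite mulr0.
- move=> p1 p2 [B1 -> T1] [B2 -> T2]; exists (fun j => B1 j + B2 j) => [|j].
    by rewrite -big_split; apply: eq_bigr => j _; rewrite mulrDr.
  exact: degsD.
move=> m /Sp /ST[m1 Tm].
have ex (m' : 'X_{1..n}) : (0 < mdeg m')%N -> exists i, (U_(i) <= m')%MM.
  move=> m0; case: (pickP (fun i => m' i != 0%N)) => [i mi|m'0].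
    by exists i; rewrite lep1mP.
  suff e : m' = 0%MM by rewrite e mdeg0 in m0.
  by apply/mnmP => i; rewrite mnm0E; apply/eqP/negbFE/m'0.
have [i im] := ex m (ltnW m1).
have mdi : mdeg (m - U_(i))%MM = (mdeg m).-1.
  by have := mdegD (m - U_(i)) U_(i); rewrite submK // mdeg1 => ->;
    rewrite addn1.
have [k km] : exists k, (U_(k) <= m - U_(i))%MM by apply: ex; rewrite mdi; lia.
have mdk : mdeg (m - U_(i) - U_(k))%MM = (mdeg m - 2)%N.
  have := mdegD (m - U_(i) - U_(k)) U_(k); rewrite submK // mdeg1 mdi; lia.
exists (fun j => if j == (i, k) then p@_m *: 'X_[m - U_(i) - U_(k)] else 0) =>
  [|j].
  rewrite (bigD1 (i, k)) //= eqxx big1 ?addr0 => [|j /negbTE->];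
    last by rewrite mulr0.
  rewrite -scalerAr -!mpolyXD; congr (_ *: 'X_[_]).
  by rewrite -addmA [(U_(k) + _)%MM]addmC submK // addmC submK.
by case: eqP => _; [apply/degsZ/degsX; rewrite mdk | apply: degs0].
Qed.

End Decompositions.

Definition btw (a b : nat) : pred nat := fun k => (a <= k <= b)%N.

Lemma degs_msub_linear (K : fieldType) n k (g : 'I_n -> {mpoly K[k]}) S p :
  (forall i, degs (pred1 1%N) (g i)) -> degs S p -> degs S (msub g p).
Proof.
move=> g1; apply: (degs_msub (S := fun a b => a == b)) => //.
- by move=> a b a' b' /eqP-> /eqP->.
- by move=> i; apply: degsW (g1 i) => a /= /eqP->.
- by move=> a b Sa /eqP <-.
Qed.

Section DegreeReduction.
Variable K : fieldType.

Lemma degs_var (T : finType) (S : pred nat) (t : T) : S 1%N -> degs S (var K t).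
Proof. exact: degsXU. Qed.

Lemma msub_var_sub (T : finType) (g F : T -> {mpoly K[#|T|]}) :
  (forall t, msub (g \o enum_val) (F t) = var K t) ->
  forall k, msub (g \o enum_val) ((F \o enum_val) k) = 'X_k.
Proof. by move=> h k; rewrite /= h var_enum_val. Qed.

Section ToCubic.
Variables (n D : nat) (F : 'I_n -> {mpoly K[n]}).
Variables (L : 'I_n -> {mpoly K[n]}) (B : 'I_n -> 'I_n * 'I_n -> {mpoly K[n]}).
Local Notation J := ('I_n * 'I_n)%type.
Local Notation W := (J + 'I_n * J)%type.
Local Notation T := ('I_n + W)%type.
Local Notation MP := {mpoly K[#|{: T}|]}.
(* With new variables y_jk and z_ijk, the map Fh below is E1 o (F, id) o E2,
   where E2 adds x_j x_k to y_jk and B_ijk to z_ijk, and E1 adds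
   sum_jk y_jk z_ijk to x_i: the products x_j x_k B_ijk cancel, and only the
   terms y z, x x z and y B of lower degree remain. *)
Local Notation x i := (var K (inl i : T)).
Local Notation y j := (var K (inr (inl j) : T)).
Local Notation z i j := (var K (inr (inr (i, j)) : T)).
Local Notation iota := (msub (@inl_var K n W)).
Hypothesis FE : forall i,
  F i = 'X_i - (L i + \sum_j 'X_(j.1) * 'X_(j.2) * B i j).

Let E1 (t : T) : MP := match t with
  | inl i => x i + \sum_j y j * z i j
  | inr w => var K (inr w) end.

Let E2s (c : MP) (t : T) : MP := match t with
  | inl i => x i
  | inr (inl j) => y j + c * (x j.1 * x j.2)
  | inr (inr (i, j)) => z i j + c * iota (B i j) end.

Let Fh (t : T) : MP := match t with
  | inl i => x i - (iota (L i) -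
      \sum_j (y j * z i j + x j.1 * x j.2 * z i j + y j * iota (B i j)))
  | inr (inl j) => y j - - (x j.1 * x j.2)
  | inr (inr (i, j)) => z i j - - iota (B i j) end.

Lemma E2_iota c p : msub (E2s c \o enum_val) (iota p) = iota p.
Proof. exact: msub_inl. Qed.

Lemma FhE t : Fh t =
  msub (E2s 1 \o enum_val) (msub (extension F \o enum_val) (E1 t)).
Proof.
case: t => [i|w] /=; last first.
  rewrite !msub_var; case: w => [j|[i j]] /=; by rewrite opprK mul1r.
have e1 : msub (E2s 1 \o enum_val)
      (msub (extension F \o enum_val) (\sum_j y j * z i j)) =
    \sum_j (y j + x j.1 * x j.2) * (z i j + iota (B i j)).
  rewrite [msub (extension F \o _) _]rmorph_sum [LHS]rmorph_sum.
  apply: eq_bigr => j _; rewrite /= !rmorphM /= !msub_var /=.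
  by rewrite !mul1r.
have e2 : iota (\sum_j 'X_(j.1) * 'X_(j.2) * B i j) =
    \sum_j x j.1 * x j.2 * iota (B i j).
  by rewrite rmorph_sum; apply: eq_bigr => j _; rewrite /= !rmorphM /= !mmapXU.
rewrite rmorphD /= msub_var rmorphD /= E2_iota e1 FE rmorphB rmorphD /= mmapXU
  e2.
rewrite [X in _ - (_ - X)](_ : _ = \sum_j (y j + x j.1 * x j.2) * (z i j + iota
  (B i j)) -
    \sum_j x j.1 * x j.2 * iota (B i j)); last first.
  by rewrite -sumrB; apply: eq_bigr => j _; ring.
rewrite /inl_var; ring.
Qed.

(** The polynomials added to [y] and [z] involve [x] alone, so changing the sign of [c] inverts the
    map. *)
Lemma E2K t : msub (E2s (-1) \o enum_val) (E2s 1 t) = var K t.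
Proof.
case: t => [i|[j|[i j]]] /=; first by rewrite msub_var.
  by rewrite rmorphD !rmorphM rmorph1 /= !msub_var /=; ring.
by rewrite rmorphD rmorphM rmorph1 /= msub_var E2_iota /=; ring.
Qed.

Lemma keller_E1 : keller (E1 \o enum_val).
Proof.
apply: (@keller_left_block _ _ _ _ (fun i j => (i == j)%:R)) => // i j.
rewrite (bigD1 j) //= eqxx mulr1 [X in _ + X]big1 ?addr0 => [|k /negbTE->];
  last by rewrite mulr0.
rewrite mderivD mderiv_var raddf_sum big1 ?addr0 // => k _.
by rewrite /= mderivM !mderiv_var /= mul0r mulr0 addr0.
Qed.

Lemma keller_E2 : keller (E2s 1 \o enum_val).
Proof.
apply: (@keller_right_block _ _ _ _ (fun i j => (i == j)%:R)) => // w w'.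
rewrite (bigD1 w') //= eqxx mulr1 [X in _ + X]big1 ?addr0 => [|k /negbTE->];
  last by rewrite mulr0.
case: w => [j|[i j]] /=;
  rewrite mderivD mderiv_var mderivM mul1r -[1]/(1%:MP) mderivC.
  by rewrite mderivM !mderiv_var mul0r !(mulr0, mul0r) !addr0.
by rewrite mderiv_msub_inr mul0r !addr0.
Qed.

Hypothesis D4 : (3 < D)%N.
Hypothesis LD : forall i, degs (btw 2 3) (L i).
Hypothesis BD : forall i j, degs (btw 2 (D - 2)) (B i j).

(** The terms [x x] and [y z] have degree 2, [x x z] has degree 3, [B] at most [D - 2] and [y B] at
    most [D - 1]; and [3 <= D - 1]. *)
Lemma degs_Fh t : degs (btw 2 D.-1) (var K t - Fh t).
Proof.
have iD i j : degs (btw 2 (D - 2)) (iota (B i j)).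
  by apply: degs_msub_linear => // k; apply: degs_var.
have vv (s t' : T) : degs (pred1 2%N) (var K s * var K t').
  by apply: (degsM (S1 := pred1 1%N) (S2 := pred1 1%N)) =>
    [a b /eqP-> /eqP->||];
    [ | exact: degs_var | exact: degs_var].
have W23 p : degs (btw 2 3) p -> degs (btw 2 D.-1) p.
  by apply: degsW => a; rewrite /btw; lia.
case: t => [i|[j|[i j]]] /=; rewrite opprB addrC subrK.
- apply: degsB; first by apply/W23/degs_msub_linear => // k; apply: degs_var.
  apply: degs_sum => j _; apply: degsD; first apply: degsD.
  + by apply: (degsW _ (vv _ _)) => a /= /eqP->; rewrite /btw; lia.
  + apply: (degsM (S1 := pred1 2%N) (S2 := pred1 1%N)) => [a b /eqP-> /eqP->||];
      [rewrite /btw; lia | exact: vv | exact: degs_var].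
  + apply: (degsM (S1 := pred1 1%N) (S2 := btw 2 (D - 2))) => [a b /eqP->||];
      [rewrite /btw; lia | exact: degs_var | exact: iD].
- by apply/degsN; apply: (degsW _ (vv _ _)) => a /= /eqP->; rewrite /btw; lia.
by apply/degsN; apply: degsW (iD i j) => a; rewrite /btw; lia.
Qed.

Lemma degree_step :
  (forall N (G : 'I_N -> {mpoly K[N]}), keller G ->
    (forall i, degs (btw 2 D.-1) ('X_i - G i)) -> left_invertible G) ->
  keller F -> left_invertible F.
Proof.
(* On the slice where all new variables are zero, [(F, id)] restricts to [F]. *)
move=> IH KF; apply: (@left_invertible_block _ _ W _ (fun=> 0) (extension F)).
  case=> [i|w] /=; last by rewrite msub_var rmorph0.
  rewrite msub_inl mmapXU -[RHS]msub_id; apply: eq_mmap => //.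
apply: (@left_invertible_conj _ _ (E1 \o enum_val) _ (E2s 1 \o enum_val)
   (E2s (-1) \o enum_val) (Fh \o enum_val)).
- by move=> k; apply: FhE.
- exact: msub_var_sub E2K.
apply: IH => [|k]; last by rewrite -var_enum_val; apply: degs_Fh.
have := keller_comp (keller_comp keller_E1 (keller_extension W KF)) keller_E2.
by apply: eq_keller => k; rewrite -[RHS]/(Fh (enum_val k)) FhE.
Qed.

End ToCubic.
End DegreeReduction.

(** * Homogenization to cubic terms *)

Section Homogenization.
Variable K : fieldType.
Variables (n : nat) (F L2 L3 : 'I_n -> {mpoly K[n]}).
Local Notation W := ('I_n + unit)%type.
Local Notation T := ('I_n + W)%type.
Local Notation MP := {mpoly K[#|{: T}|]}.
Local Notation x i := (var K (inl i : T)).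
Local Notation y i := (var K (inr (inl i) : T)).
Local Notation t := (var K (inr (inr tt) : T)).
Local Notation iota := (msub (@inl_var K n W)).
Hypothesis FE : forall i, F i = 'X_i - (L2 i + L3 i).
Hypothesis L2h : forall i, degs (pred1 2%N) (L2 i).
Hypothesis L3h : forall i, degs (pred1 3%N) (L3 i).

(* F1 is F(t x) / t, and Fh = E1 o F1 o E2 is homogeneous of degree 3 up
   to its linear part. *)
Let F1 (s : T) : MP := match s with
  | inl i => x i - (t * iota (L2 i) + t ^+ 2 * iota (L3 i))
  | inr w => var K (inr w) end.

Let E1 (s : T) : MP := match s with
  | inl i => x i + t ^+ 2 * y i
  | inr w => var K (inr w) end.

Let E2s (c : MP) (s : T) : MP := match s with
  | inl i => x i
  | inr (inl i) => y i + c * iota (L3 i)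
  | inr (inr _) => t end.

Let Fh (s : T) : MP := match s with
  | inl i => x i - (t * iota (L2 i) - t ^+ 2 * y i)
  | inr (inl i) => y i - - iota (L3 i)
  | inr (inr _) => t end.

Let E2_iota c p : msub (E2s c \o enum_val) (iota p) = iota p.
Proof. exact: msub_inl. Qed.

Let FhE s : Fh s = msub (E2s 1 \o enum_val) (msub (F1 \o enum_val) (E1 s)).
Proof.
case: s => [i|[i|[]]];
  rewrite /Fh /E1 ?msub_var /= ?msub_var /= ?mul1r ?opprK //.
have -> : msub (F1 \o enum_val) (x i + t ^+ 2 * y i) = F1 (inl i) + t ^+ 2 * y
  i.
  by rewrite rmorphD rmorphM rmorphXn /= !msub_var.
have E2M (p q : MP) : msub (E2s 1 \o enum_val) (p * q) =
    msub (E2s 1 \o enum_val) p * msub (E2s 1 \o enum_val) q.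
  exact: rmorphM.
rewrite rmorphD rmorphB rmorphD /= !expr2 !E2M !msub_var /= !E2_iota; ring.
Qed.

Let E2K s : msub (E2s (-1) \o enum_val) (E2s 1 s) = var K s.
Proof.
case: s => [i|[i|[]]] /=; rewrite ?msub_var //.
by rewrite rmorphD rmorphM rmorph1 /= msub_var E2_iota /=; ring.
Qed.

Let keller_E1 : keller (E1 \o enum_val).
Proof.
apply: (@keller_left_block _ _ _ _ (fun i j => (i == j)%:R)) => // i j.
rewrite (bigD1 j) //= eqxx mulr1 [X in _ + X]big1 ?addr0 => [|k /negbTE->];
  last by rewrite mulr0.
by rewrite mderivD mderivM expr2 mderivM !mderiv_var /= !(mul0r, mulr0, addr0).
Qed.

Let keller_E2 : keller (E2s 1 \o enum_val).
Proof.
apply: (@keller_right_block _ _ _ _ (fun i j => (i == j)%:R)) => // w w'.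
rewrite (bigD1 w') //= eqxx mulr1 [X in _ + X]big1 ?addr0 => [|k /negbTE->];
  last by rewrite mulr0.
case: w => [i|[]] /=; last by rewrite mderiv_var.
by rewrite mul1r mderivD mderiv_var mderiv_msub_inr addr0.
Qed.

(** Differentiating [t F1 = F(t x)] and cancelling [t] shows that the Jacobian block is [JF(t x)],
    so the inverse of [JF] is evaluated at [t x]. *)
Let keller_F1 : keller F -> keller (F1 \o enum_val).
Proof.
move=> [B FB]; pose rho i : MP := t * x i.
have t0 : t != 0 by rewrite /var -msupp_eq0 msuppX.
have rhoE k p : degs (pred1 k) p -> msub rho p = t ^+ k * iota p.
  by move=> pk; rewrite -(@mmap_scale_homog _ _ _ (@mpolyC _ K)).
have tF i : t * F1 (inl i) = msub rho (F i).
  rewrite FE rmorphB rmorphD /= mmapXU (rhoE 2%N) // (rhoE 3%N) // /rho; ring.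
have dF i k : (F1 (inl i))^`M(enum_rank (inl k : T)) = msub rho (F i)^`M(k).
  apply: (mulfI t0); have := congr1 (mderiv (enum_rank (inl k : T))) (tF i).
  rewrite mderivM mderiv_var mul0r add0r => ->.
  rewrite mderiv_msub (bigD1 k) //= big1 ?addr0 => [|l lk].
    by rewrite mderivM !mderiv_var eqxx /= mul0r add0r mulr1 mulrC.
  rewrite mderivM !mderiv_var /= mul0r add0r.
  by rewrite (_ : (inl l == inl k :> T) = (l == k)) // (negbTE lk) !mulr0.
apply: (@keller_left_block _ _ _ _ (fun i j => msub rho (B i j))) => // i j.
rewrite -[RHS](rmorph_nat (msub rho)).
have /matrixP/(_ i j) := FB; rewrite !mxE => <-; rewrite rmorph_sum.
by apply: eq_bigr => k _; rewrite dF /= rmorphM mxE.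
Qed.

Let degs_Fh s : degs (pred1 3%N) (var K s - Fh s).
Proof.
have i3 i : degs (pred1 3%N) (iota (L3 i)).
  by apply: degs_msub_linear => // k; apply: degs_var.
have M12 (p q : MP) : degs (pred1 1%N) p -> degs (pred1 2%N) q ->
  degs (pred1 3%N) (p * q).
  by apply: degsM => a b /eqP-> /eqP->.
case: s => [i|[i|[]]] /=; last by rewrite subrr; apply: degs0.
  rewrite opprB addrC subrK; apply: degsB.
    by apply: M12; [apply: degs_var | apply: degs_msub_linear => // k;
      apply: degs_var].
  rewrite mulrC; apply: M12; first exact: degs_var.
  by apply: (degs_exp (k := 1%N)) => //; apply: degs_var.
by rewrite opprB addrC subrK; apply: degsN.
Qed.

Lemma homogenization_step :
  (forall N (G : 'I_N -> {mpoly K[N]}), keller G ->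
    (forall i, degs (pred1 3%N) ('X_i - G i)) -> left_invertible G) ->
  keller F -> left_invertible F.
Proof.
(* On the slice [y = 0], [t = 1] the map [F1] restricts to [F]. *)
move=> IH KF; pose c (w : W) : {mpoly K[n]} := if w is inl _ then 0 else 1.
apply: (@left_invertible_block _ _ W _ c F1).
  case=> [i|w] /=; last first.
    by rewrite msub_var; case: w => [i|[]]; rewrite ?rmorph0 ?rmorph1.
  rewrite rmorphB rmorphD expr2 !rmorphM /= !msub_var /= !msub_inl.
  rewrite !mul1r mmapXU FE; congr (_ - (_ + _)).
    exact: msub_id.
  exact: msub_id.
apply: (@left_invertible_conj _ _ (E1 \o enum_val) _ (E2s 1 \o enum_val)
   (E2s (-1) \o enum_val) (Fh \o enum_val)).
- by move=> k; apply: FhE.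
- exact: msub_var_sub E2K.
apply: IH => [|k]; last by rewrite -var_enum_val; apply: degs_Fh.
have := keller_comp (keller_comp keller_E1 (keller_F1 KF)) keller_E2.
by apply: eq_keller => k; rewrite -[RHS]/(Fh (enum_val k)) FhE.
Qed.

End Homogenization.


(* Compare the components of degree k r in B = sum_(l < r) M^l + M^r B. *)
Lemma homog_nilpotent (K : fieldType) n k (M B : 'M[{mpoly K[n]}]_n) :
  (0 < k)%N -> (forall i j, degs (pred1 k) (M i j)) ->
  (1%:M - M) *m B = 1%:M -> exists r, M ^+ r = 0.
Proof.
move=> k0 Mk MB.
have Mr r i j : degs (pred1 (k * r)%N) ((M ^+ r) i j).
  elim: r i j => [|r IH] i j.
    by rewrite expr0 mxE; case: eqP => _; [apply: degs1;
      rewrite muln0 /= | apply: degs0].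
  rewrite exprS mxE; apply: degs_sum => l _.
  by apply: degsM (Mk i l) (IH l j) => a b /= /eqP-> /eqP->; rewrite mulnS.
have Br r : B = \sum_(l < r) M ^+ l + M ^+ r *m B.
  elim: r => [|r IH]; first by rewrite big_ord0 add0r expr0 mul1mx.
  rewrite {1}IH big_ord_recr /= -addrA exprSr -[M ^+ r * M]/(_ *m _) -mulmxA.
  congr (_ + _); rewrite -{2}[M ^+ r]mulmx1 -mulmxDr; congr (_ *m _).
  by rewrite -MB mulmxBl mul1mx subrK.
(* All entries of [B] have degree below [r <= k r], hence no component of degree [k r]. *)
pose r := \max_(ij : 'I_n * 'I_n) msize (B ij.1 ij.2).
exists r; apply/matrixP => i j; rewrite [RHS]mxE.
apply: (degs_eq0 (S := fun a => (a == k * r)%N && (a != k * r)%N)); last first.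
  by move=> a; rewrite andbN.
suff ne : degs (fun a => a != k * r)%N ((M ^+ r) i j).
  by move=> m mM; rewrite (ne _ mM) andbT; apply: Mr mM.
have -> : M ^+ r = B - \sum_(l < r) M ^+ l - M ^+ r.+1 *m B.
  rewrite {1}(Br r.+1) big_ord_recr /=; set s := \sum_(_ < _) _.
  by rewrite addrAC addrK [s + _]addrC addrK.
rewrite !mxE; apply: degsB; first apply: degsB.
- have : degs (fun a => a < msize (B i j))%N (B i j) by apply/degs_msize.
  apply: degsW => a ab; have Br' : (msize (B i j) <= r)%N.
    exact: (@leq_bigmax _ (fun ij : 'I_n * 'I_n => msize (B ij.1 ij.2)) (i, j)).
  have ar := leq_trans ab Br'; rewrite neq_ltn (leq_trans ar) // leq_pmull //.
- rewrite summxE; apply: degs_sum => l _;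
  apply: degsW (Mr l i j) => a /= /eqP->.
  by rewrite eqn_pmul2l // neq_ltn ltn_ord.
apply: degs_sum => l _;
  apply: (degsM (S2 := predT) _ (Mr r.+1 i l)) => // a b /= /eqP-> _.
by rewrite neq_ltn orbC mulnS; lia.
Qed.

(** * Passage to a gradient map in twice as many variables *)

Section Symmetrization.
Variable K : numClosedFieldType.
Variables (n : nat) (F : 'I_n -> {mpoly K[n]}).
Local Notation T := ('I_n + 'I_n)%type.
Local Notation MP := {mpoly K[#|{: T}|]}.
Local Notation x i := (var K (inl i : T)).
Local Notation y i := (var K (inr i : T)).
Local Notation iota := (msub (@inl_var K n 'I_n)).
Let H i := 'X_i - F i.
Hypothesis H3 : forall i, degs (pred1 3%N) (H i).

(* The Hamiltonian P0 satisfies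
   (x_i, y_i) - 2 (dP0/dy_i, dP0/dx_i) = (F(x), JF(x)^T y);
   in the coordinates u, v with x = u + i v and y = u - i v, this is the
   gradient map of P. *)
Let P0 : MP := 2^-1 *: \sum_j y j * iota (H j).

Let S (s : T) : MP := match s with
  | inl i => x i
  | inr i => \sum_j iota (F j)^`M(i) * y j end.

Let F2 (s : T) : MP := match s with
  | inl i => iota (F i)
  | inr i => \sum_j iota (F j)^`M(i) * y j end.

Let Lam (s : T) : MP := match s with
  | inl i => x i + 'i *: y i
  | inr i => x i - 'i *: y i end.

Let LamI (s : T) : MP := match s with
  | inl i => 2^-1 *: (x i + y i)
  | inr i => (2 * 'i)^-1 *: (x i - y i) end.

Let P : MP := msub (Lam \o enum_val) P0.

Let Fh (s : T) : MP := var K s - P^`M(enum_rank s).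

Let two0 : (2 : K) != 0. Proof. by rewrite pnatr_eq0. Qed.
Let msubZ k (g : 'I_#|{: T}| -> {mpoly K[k]}) c (p : MP) :
  msub g (c *: p) = c *: msub g p.
Proof. by rewrite mmapZ mul_mpolyC. Qed.

Let LamK s : msub (LamI \o enum_val) (Lam s) = var K s.
Proof.
have e i : 'i *: ((2 * 'i)^-1 *: (x i - y i)) = 2^-1 *: (x i - y i).
  by rewrite scalerA invfM mulrCA mulfV ?neq0Ci // mulr1.
have e2 (p : MP) : 2^-1 *: p + 2^-1 *: p = p.
  by rewrite -scalerDl -[RHS]scale1r; congr (_ *: _); field.
case: s => i; rewrite /= rmorphD ?rmorphN /= msubZ !msub_var /= e.
  rewrite -scalerDr addrACA subrr addr0 scalerDr; exact: e2.
rewrite -scalerBr opprB [X in _ *: X]addrC addrA subrK scalerDr; exact: e2.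
Qed.

Let LamIK s : msub (Lam \o enum_val) (LamI s) = var K s.
Proof.
case: s => i; rewrite /= msubZ rmorphD ?rmorphN /= !msub_var /=.
  rewrite addrACA subrr addr0 scalerDr -scalerDl.
  by rewrite -[RHS]scale1r; congr (_ *: _); field.
rewrite opprB [X in _ *: X]addrC addrA subrK scalerDr !scalerA -scalerDl.
by rewrite -[RHS]scale1r; congr (_ *: _); field; rewrite neq0Ci.
Qed.

Let dP0y i : P0^`M(enum_rank (inr i : T)) = 2^-1 *: iota (H i).
Proof.
rewrite /P0 mderivZ; congr (_ *: _).
rewrite raddf_sum (bigD1 i) //= big1 ?addr0 => [|j ji].
  by rewrite mderivM mderiv_msub_inr mderiv_var eqxx mul1r mulr0 addr0.
rewrite mderivM mderiv_msub_inr mderiv_var mulr0 addr0.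
by rewrite (_ : (inr j == inr i :> T) = (j == i)) // (negbTE ji) mul0r.
Qed.

Let dP0x i : P0^`M(enum_rank (inl i : T)) = 2^-1 *: \sum_j y j * iota (H
  j)^`M(i).
Proof.
rewrite /P0 mderivZ; congr (_ *: _); rewrite raddf_sum; apply: eq_bigr => j _.
by rewrite /= mderivM mderiv_msub_inl mderiv_var mul0r add0r.
Qed.

Let dPu i : P^`M(enum_rank (inl i : T)) =
  msub (Lam \o enum_val) (P0^`M(enum_rank (inl i : T)) + P0^`M(enum_rank (inr i
    : T))).
Proof.
rewrite /P mderiv_msub (reindex _ (onW_bij _ (@enum_rank_bij T))) big_sumType
  /=.
rewrite (bigD1 i) //= [X in _ + X + _]big1 => [|j ji]; last first.
  rewrite enum_rankK /= mderivD !mderivZ !mderiv_var /= ?mulr0n scaler0 addr0.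
  by rewrite (_ : (inl j == inl i :> T) = (j == i)) // (negbTE ji) mulr0.
rewrite [X in _ + X](bigD1 i) //= [X in _ + (_ + X)]big1 => [|j ji]; last first.
  rewrite enum_rankK /= mderivB !mderivZ !mderiv_var /= ?mulr0n scaler0 subr0.
  by rewrite (_ : (inl j == inl i :> T) = (j == i)) // (negbTE ji) mulr0.
rewrite !enum_rankK /= mderivB mderivD !mderivZ !mderiv_var /= eqxx ?mulr0n
  scaler0.
by rewrite subr0 !addr0 !mulr1 rmorphD.
Qed.

Let dPv i : P^`M(enum_rank (inr i : T)) = 'i *:
  msub (Lam \o enum_val) (P0^`M(enum_rank (inl i : T)) - P0^`M(enum_rank (inr i
    : T))).
Proof.
rewrite /P mderiv_msub (reindex _ (onW_bij _ (@enum_rank_bij T))) big_sumType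
  /=.
rewrite (bigD1 i) //= [X in _ + X + _]big1 => [|j ji]; last first.
  rewrite enum_rankK /= mderivD !mderivZ !mderiv_var /= ?mulr0n add0r.
  by rewrite (_ : (inr j == inr i :> T) = (j == i)) // (negbTE ji) scaler0
    mulr0.
rewrite [X in _ + X](bigD1 i) //= [X in _ + (_ + X)]big1 => [|j ji]; last first.
  rewrite enum_rankK /= mderivB !mderivZ !mderiv_var /= ?mulr0n sub0r.
  by rewrite (_ : (inr j == inr i :> T) = (j == i)) // (negbTE ji) scaler0
    oppr0 mulr0.
rewrite !enum_rankK /= mderivB mderivD !mderivZ !mderiv_var /= eqxx ?mulr0n.
rewrite add0r sub0r !addr0 rmorphB /= scalerBr !mulrN -!scalerAr !mulr1 //.
Qed.

(** By the chain rule [P] has derivatives [P0_x + P0_y] along [u] and [i (P0_x - P0_y)] along [v];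
    these are the components of [LamI] at [(2 P0_y, 2 P0_x)]. *)
Let FhE s : Fh s = msub (Lam \o enum_val) (msub (F2 \o enum_val) (LamI s)).
Proof.
have Fy i : msub (F2 \o enum_val) (y i) = y i - 2 *: P0^`M(enum_rank (inl i :
  T)).
  rewrite msub_var dP0x scalerA mulfV // scale1r /=.
  have -> : \sum_j y j * iota (H j)^`M(i) =
      \sum_j (y j * (i == j)%:R - iota (F j)^`M(i) * y j).
    apply: eq_bigr => j _; rewrite mderivB mderivXU rmorphB /= rmorph_nat.
    by rewrite mulrBr eq_sym [y j * iota _]mulrC.
  rewrite sumrB [X in _ - (X - _)](bigD1 i) //= eqxx mulr1.
  rewrite [X in _ - (_ + X - _)]big1 ?addr0 => [|j ji].
    by rewrite opprB addrC subrK.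
  by rewrite eq_sym (negbTE ji) mulr0.
have Fx i : msub (F2 \o enum_val) (x i) = x i - 2 *: P0^`M(enum_rank (inr i :
  T)).
  rewrite msub_var dP0y scalerA mulfV // scale1r /= /H rmorphB /= mmapXU.
  by rewrite opprB addrC subrK.
have e1 (u w a b : MP) :
    2^-1 *: ((u - 2 *: b) + (w - 2 *: a)) = 2^-1 *: (u + w) - (a + b).
  rewrite addrACA -opprD -scalerDr scalerBr scalerA mulVf // scale1r.
  by rewrite [b + a]addrC.
have e2 (u w a b : MP) :
    (2 * 'i)^-1 *: ((u - 2 *: b) - (w - 2 *: a)) =
    (2 * 'i)^-1 *: (u - w) - 'i *: (a - b).
  have -> : (u - 2 *: b) - (w - 2 *: a) = (u - w) + 2 *: (a - b).
    by rewrite scalerBr; ring.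
  rewrite scalerDr scalerA invfM mulrAC mulVf // mul1r invCi scaleNr //.
have LE s' : msub (Lam \o enum_val) (LamI s') = var K s' := LamIK s'.
case: s => i.
  rewrite /Fh dPu -(LE (inl i)) -rmorphB; congr (mmap _ _ _).
  by rewrite [LamI (inl i)]/= msubZ rmorphD /= Fx Fy e1.
rewrite /Fh dPv -(LE (inr i)) -msubZ -rmorphB; congr (mmap _ _ _).
by rewrite [LamI (inr i)]/= msubZ rmorphB /= Fx Fy e2.
Qed.

Let keller_LamI : keller (LamI \o enum_val).
Proof.
apply: (keller_automorphism (G := Lam \o enum_val)).
  exact: msub_var_sub LamIK.
exact: msub_var_sub LamK.
Qed.

Let keller_Lam : keller (Lam \o enum_val).
Proof.
apply: (keller_automorphism (G := LamI \o enum_val)).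
  exact: msub_var_sub LamK.
exact: msub_var_sub LamIK.
Qed.

(** [F2] is [S] followed by [(F, id)], and the Jacobian matrix of [S] is block triangular with block
    [JF^T]. *)
Let keller_F2 : keller F -> keller (F2 \o enum_val).
Proof.
move=> KF; have KS : keller (S \o enum_val).
  have [B FB] := KF.
  apply: (@keller_right_block _ _ _ _ (fun k j => iota (B j k))) => // i j.
  have /matrixP/(_ j i) := mulmx1C FB; rewrite !mxE eq_sym => e.
  rewrite -[RHS](rmorph_nat iota) -e rmorph_sum; apply: eq_bigr => k _.
  rewrite rmorphM mxE mulrC; congr (_ * _); rewrite /= raddf_sum (bigD1 k) //=.
  rewrite mderivM mderiv_msub_inr mderiv_var eqxx mul0r add0r mulr1 big1 ?addr0
    //.
  move=> l lk; rewrite mderivM mderiv_msub_inr mderiv_var mul0r add0r.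
  by rewrite (_ : (inr l == inr k :> T) = (l == k)) // (negbTE lk) mulr0.
have := keller_comp (keller_extension 'I_n KF) KS.
apply: eq_keller => k /=; case: (enum_val k) => i /=; last by rewrite msub_var.
exact: msub_inl.
Qed.

Lemma symmetrization_step :
  (forall N (Q : {mpoly K[N]}), Q \is 4.-homog -> hessian_nilpotent Q ->
    left_invertible (fun i => 'X_i - Q^`M(i))) ->
  keller F -> left_invertible F.
Proof.
move=> IH KF; apply: (@left_invertible_block _ _ 'I_n _ (fun=> 0) F2).
  case=> [i|i] /=; first by rewrite msub_inl mmapXU msub_id.
  rewrite rmorph0 rmorph_sum big1 // => j _.
  by rewrite /= rmorphM /= msub_var mulr0.
have FhG k : Fh (enum_val k) = 'X_k - P^`M(k).
  by rewrite /Fh var_enum_val enum_valK.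
apply: (@left_invertible_conj _ _ (LamI \o enum_val) _ (Lam \o enum_val)
  (LamI \o enum_val) (fun k => 'X_k - P^`M(k))).
- by move=> k; rewrite -FhG FhE.
- exact: msub_var_sub LamK.
have P4 : P \is 4.-homog.
  apply/degs_homog; apply: degs_msub_linear => [k|].
    rewrite /=; case: (enum_val k) => i /=; [apply: degsD | apply: degsB];
      rewrite ?scalerN; try (by apply: degs_var); by apply/degsZ/degs_var.
  apply/degsZ/degs_sum => j _.
  apply: (degsM (S1 := pred1 1%N) (S2 := pred1 3%N)) =>
    [a b /eqP-> /eqP->||] //.
    exact: degs_var.
  apply: (@degs_msub_linear K n _ (@inl_var K n 'I_n) (pred1 3%N) (H j));
    last exact: H3. by move=> k; apply: degs_var.
apply: IH => //.
(* The Jacobian matrix is [1 - Hess P] with [Hess P] homogeneous of degree 2, so its invertibility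
   forces nilpotency. *)
have [B JB] : keller (fun k => 'X_k - P^`M(k)).
  have := keller_comp (keller_comp keller_LamI (keller_F2 KF)) keller_Lam.
  by apply: eq_keller => k; rewrite -FhG FhE.
apply: (@homog_nilpotent _ _ 2 _ B) => // [i j|].
  move/degs_homog: P4 => P4; rewrite mxE.
  apply: (degs_mderiv (S := pred1 3%N)) => [a|]; first by rewrite /= eqSS.
  by apply: degs_mderiv P4 => a; rewrite /= eqSS.
rewrite -[RHS]JB; congr (_ *m _); apply/matrixP => i j.
by rewrite !mxE mderivB mderivXU.
Qed.

End Symmetrization.

(** * Equivalence with the Jacobian conjecture *)

Section Reduction.
Variable K : numClosedFieldType.

Lemma det1_keller n (F : 'I_n -> {mpoly K[n]}) : \det (jacobian F) = 1 ->
  keller F.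
Proof.
move=> dF; exists (invmx (jacobian F)); apply: mulmxV.
by rewrite unitmxE dF unitr1.
Qed.

Lemma jacobian_conjecture_reduction :
  (forall n (Q : {mpoly K[n]}), Q \is 4.-homog -> hessian_nilpotent Q ->
    left_invertible (fun i => 'X_i - Q^`M(i))) ->
  jacobian_conjecture K.
Proof.
move=> quartic.
have cubic n (F : 'I_n -> {mpoly K[n]}) : keller F ->
    (forall i, degs (btw 2 3) ('X_i - F i)) -> left_invertible F.
  move=> KF F23.
  have /fin_all_exists2[L2 /fin_all_exists[L3 FE] _] i : exists2 L2, exists L3,
      [/\ 'X_i - F i = L2 + L3,
        degs (pred1 2%N) L2 & degs (pred1 3%N) L3] & True.
    have [p1 [p2 [e h1 h2]]] := degs_split (pred1 2%N) (F23 i).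
    exists p1 => //; exists p2; split=> //.
      by apply: degsW h1 => a /andP[].
    by apply: degsW h2 => a; rewrite /btw /=; lia.
  apply: (@homogenization_step _ _ _ L2 L3) KF => [i|i|i|N G KG G3].
  - by have [<- _ _] := FE i; rewrite opprB addrC subrK.
  - by have [] := FE i.
  - by have [] := FE i.
  by apply: symmetrization_step => //; apply: quartic.
(* Induction on the degree bound: [degree_step] lowers it by one until the cubic case. *)
have all D : forall n (F : 'I_n -> {mpoly K[n]}), keller F ->
    (forall i, degs (btw 2 D) ('X_i - F i)) -> left_invertible F.
  elim: D => [|D IH] n F KF FD.
    by apply: cubic => // i; apply: degsW (FD i) => a; rewrite /btw; lia.
  have [D3|D3] := leqP D.+1 3.
    by apply: cubic => // i; apply: degsW (FD i) => a; rewrite /btw; lia.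
  have /fin_all_exists[LB LBP] i :
      exists LB : {mpoly K[n]} * ('I_n * 'I_n -> {mpoly K[n]}),
      [/\ 'X_i - F i = LB.1 + \sum_j 'X_(j.1) * 'X_(j.2) * LB.2 j,
        degs (btw 2 3) LB.1 & forall j, degs (btw 2 (D.+1 - 2)) (LB.2 j)].
    have [p1 [p2 [e h1 h2]]] := degs_split (fun a => a <= 3)%N (FD i).
    have [|B [BE BD]] := quadratic_factor (T := btw 2 (D.+1 - 2)) _ h2.
      by move=> a; rewrite /btw /=; lia.
    exists (p1, B); split=> //=; first by rewrite e {1}BE.
    by apply: degsW h1 => a; rewrite /btw /=; lia.
  apply: (@degree_step _ _ D.+1 _ (fun i => (LB i).1) (fun i =>
    (LB i).2)) KF => //.
  - by move=> i; have [<- _ _] := LBP i; rewrite opprB addrC subrK.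
  - by move=> i; have [] := LBP i.
  - by move=> i j; have [_ _] := LBP i.
move=> n H n0 H2 F dF.
have FT : tangent_id F.
  by move=> i; rewrite /F addrAC subrr sub0r; apply: degsN => m /H2.
have [G GF] : left_invertible F.
  apply: (all (\max_i msize (H i))); first exact: det1_keller.
  move=> i m; rewrite /F opprB addrC subrK => mH.
  rewrite /btw (H2 _ _ mH) /=; apply: leq_trans (leq_bigmax i).
  exact/ltnW/msize_mdeg_lt.
apply/polynomial_formal_inverseP; first exact: tangent_id_ge1.
exists G; split=> //; last exact: msub_inv_sym GF.
(* [G] and [G(F) = x] differ in order at least 1, so [G] has no constant term. *)
move=> i; have := msub_tangent (a := 0) FT (p := G i).
rewrite GF => /(_ (fun _ _ => isT)) h.
by rewrite -[G i](subKr 'X_i); apply: degsB => //; apply: degsXU.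
Qed.

Lemma quartic_vanishing_jacobian :
  (forall n, (1 <= n)%N -> forall P : {mpoly K[n]}, P \is 4.-homog ->
    hessian_nilpotent P -> vanishing1 4 P) -> jacobian_conjecture K.
Proof.
move=> van; apply: jacobian_conjecture_reduction => n Q Q4 HN.
(* The hypothesis speaks of [n >= 1]; in zero variables there is nothing to invert. *)
case: n Q Q4 HN => [|n] Q Q4 HN; first by exists (fun i => 'X_i) => -[].
have [M alphaM] : exists M : nat, alpha n.+1 4 < M%:R.
  exists (Num.bound `|alpha n.+1 4|); apply: le_lt_trans (ler_norm _) _.
  exact/archi_boundP/normr_ge0.
have [|G [_ _ GF]] := @gradient_inverse _ _ 4 Q M isT Q4 HN; last by exists G.
move=> m Mm; apply: (van n.+1 isT Q Q4 HN m).
by apply: lt_le_trans alphaM _; rewrite ler_nat.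
Qed.

Lemma det_sub_nilpotent (R : idomainType) n (A : 'M[R]_n) r :
  A ^+ r = 0 -> \det (1%:M - A) = 1.
Proof.
move=> Ar; transitivity (horner_eval 1 (char_poly A)); last first.
  by rewrite (nilpotent_char_poly Ar) /horner_eval hornerXn expr1n.
rewrite -det_map_mx; congr (\det _).
by apply/matrixP => i j;
  rewrite !mxE /= /horner_eval hornerD hornerN hornerC hornerMn hornerX.
Qed.

(** For [d > 2] the inverse of [x - grad P] has degree at most [(d-1)^(n-1)], which
    [inverse_degree_vanishing] turns into (1). *)
Lemma jacobian_vanishing : jacobian_conjecture K ->
  forall n d (P : {mpoly K[n]}), (1 <= n)%N -> (2 <= d)%N ->
    P \is d.-homog -> hessian_nilpotent P -> vanishing1 d P.
Proof.
move=> JC n d P n0; rewrite leq_eqVlt => /orP[/eqP<-|d2] Pd HN m.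
  rewrite /alpha eqxx => am; apply: quadratic_vanishing => //.
  suff: (n < m + 2)%N by lia.
  by rewrite -(ltr_nat rat) natrD; lra.
have [r nil] := HN.
have jac : jacobian (fun i => 'X_i - P^`M(i)) = 1%:M - hessian P.
  by apply/matrixP => i j; rewrite !mxE mderivB mderivXU eq_sym.
have Pg i : degs (pred1 d.-1) P^`M(i).
  by move/degs_homog: Pd; apply: degs_mderiv => a /=; lia.
have F1 i : degs (leq 1) ('X_i - P^`M(i)).
  by apply: degsB; [apply: degsXU | apply: degsW (Pg i) => a /= /eqP->; lia].
have : has_polynomial_formal_inverse (fun i => 'X_i - P^`M(i)).
  apply: (JC n (fun i => P^`M(i)) n0) => [i a /Pg /eqP->|]; first by lia.
  by rewrite jac; apply: det_sub_nilpotent nil.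
case/(polynomial_formal_inverseP F1) => G [_ FG GF].
have Gdeg := degree_inverse_bound n0 (D := d.-1) _ _ FG.
move=> am; apply: (inverse_degree_vanishing (e := d.-1 ^ n.-1) d2 Pd HN GF).
  apply: Gdeg; first by lia.
  by move=> i; apply: degsB; [apply: degsXU;
    lia | apply: degsW (Pg i) => a /= /eqP->].
(* Multiplied by [d - 2], the bound [m > alpha] reads [(d-1)^(n-1) < (d-2) m + (d-1) = 1 + (d-2)
   (m+1)]. *)
move: am; rewrite /alpha gtn_eqF // => am.
have dp : 0 < d%:R - 2 :> rat by rewrite subr_gt0 ltr_nat.
rewrite -(ltr_nat rat) natrX natrD natrM natrB; last exact: ltnW.
have -> : (d.-1)%:R = d%:R - 1 :> rat by rewrite -subn1 natrB //; lia.
rewrite -[m.+1]addn1 natrD; move: am; rewrite mulrC ltr_pdivrMr //.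
by move: (_ ^+ _) => z; nra.
Qed.

End Reduction.

Theorem proposition7p4 (R : realType) :
  [/\ forall (n d : nat) (P : {mpoly R[i][n]}),
        (1 <= n)%N -> (2 <= d)%N -> P \is d.-homog -> hessian_nilpotent P ->
        (vanishing1 d P <-> vanishing2 d P),
      (forall (n d : nat), (1 <= n)%N -> (2 <= d)%N ->
        forall P : {mpoly R[i][n]}, P \is d.-homog -> hessian_nilpotent P ->
          vanishing1 d P /\ vanishing2 d P)
        <-> jacobian_conjecture R[i]
    & (forall n : nat, (1 <= n)%N ->
        forall P : {mpoly R[i][n]}, P \is 4.-homog -> hessian_nilpotent P ->
          vanishing1 4 P /\ vanishing2 4 P)
        <-> jacobian_conjecture R[i]].
Proof.
split=> [n d P _ _ _ HN||]; first exact: vanishing_equiv.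
  split=> [van|JC n d n1 d2 P Pd HN].
    (* The implication passes through the case [d = 4]. *)
    by apply: quartic_vanishing_jacobian => n n1 P Pd HN;
      have [] := van n 4 n1 isT P Pd HN.
  by have V := jacobian_vanishing JC n1 d2 Pd HN; split=> //;
    apply/vanishing_equiv.
split=> [van|JC n n1 P Pd HN].
  by apply: quartic_vanishing_jacobian => n n1 P Pd HN;
    have [] := van n n1 P Pd HN.
have V := jacobian_vanishing JC n1 (isT : 2 <= 4)%N Pd HN.
by split=> //; apply/vanishing_equiv.
Qed.
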